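(* Let $n\le p$, and let $f\in W^{1,p}_{loc}(\mathbb{R}^n)\cap C(\mathbb{R}^n)$ be bounded below. If $f$ is a weak subsolution of the $p$-Laplace equation $\operatorname{div}(|\nabla f|^{p-2}\nabla f)=0$ on $\mathbb{R}^n$ with constant $p$-tension field, i.e. $\operatorname{div}(|\nabla f|^{p-2}\nabla f)=c$ weakly for some constant $c$, and with bounded weak derivative (i.e. $|\nabla f|\le C_2$ for some constant $C_2>0$), then $f$ is constant.
   Context: $f$ is a weak subsolution of the $p$-Laplace equation on $\mathbb{R}^n$ if $\int_{\mathbb{R}^n}|\nabla f|^{p-2}\nabla f\cdot\nabla\psi\,dx\le0$ for every nonnegative $\psi\in C_0^\infty(\mathbb{R}^n)$. It has constant $p$-tension field $c\in\mathbb{R}$ if $\int_{\mathbb{R}^n}|\nabla f|^{p-2}\nabla f\cdot\nabla\psi\,dx=-c\int_{\mathbb{R}^n}\psi\,dx$ for every $\psi\in C_0^\infty(\mathbb{R}^n)$.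
   Formalization: The theorem assumes p > 1 in addition to n ≤ p, which excludes only n = p = 1, where the claim fails: f = arctan on R has |f'|^{-1}f' = 1, hence zero tension field, bounded derivative and a lower bound, but is not constant. *)

(* Defs.v *)
From HB Require Import structures.
From mathcomp Require Import all_boot all_order all_algebra.
From mathcomp Require Import all_classical all_reals all_analysis.

Set Implicit Arguments.
Unset Strict Implicit.
Unset Printing Implicit Defensive.

Import Order.TTheory GRing.Theory Num.Theory.
Import numFieldNormedType.Exports.

Local Open Scope classical_set_scope.
Local Open Scope ring_scope.

(** R^n is ['rV[R]_n].  Its library norm is the sup norm (the topology is the
    usual one), so the Euclidean norm is defined separately below. *)

Section measurable_rV.
Context (R : realType) (n : nat).

Definition rV_coord (i : 'I_n) (x : 'rV[R]_n) : measurableTypeR R := x ord0 i.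

Let rV_set0 : g_sigma_preimage rV_coord set0.
Proof. exact: sigma_algebra0. Qed.

Let rV_setC A : g_sigma_preimage rV_coord A -> g_sigma_preimage rV_coord (~` A).
Proof. exact: sigma_algebraC. Qed.

Let rV_bigcup (F : _^nat) : (forall i, g_sigma_preimage rV_coord (F i)) ->
  g_sigma_preimage rV_coord (\bigcup_i (F i)).
Proof. exact: sigma_algebra_bigcup. Qed.

Definition rV_display : measure_display. Proof. exact. Qed.

(** The Borel sigma-algebra of R^n, presented as generated by the coordinates. *)
HB.instance Definition _ := @isMeasurable.Build rV_display
  'rV[R]_n (g_sigma_preimage rV_coord) rV_set0 rV_setC rV_bigcup.

End measurable_rV.

Lemma measurable_rV_coord (R : realType) n (i : 'I_n) :
  measurable_fun [set: 'rV[R]_n] (@rV_coord R n i).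
Proof.
move=> _ Y mY; rewrite setTI; apply: sub_sigma_algebra => /=.
rewrite -bigcup_seq/=; exists i => /=; first by rewrite mem_index_enum.
by exists Y => //; rewrite setTI.
Qed.

Lemma measurable_fun_rVP d (T : measurableType d) (R : realType) n
    (f : T -> 'rV[R]_n) :
  measurable_fun [set: T] f <->
  forall i, measurable_fun [set: T] (@rV_coord R n i \o f).
Proof.
split=> [mf i|mf]; first by apply: measurableT_comp; [exact: measurable_rV_coord|].
move=> _ A mA; rewrite setTI.
have H : g_sigma_preimage (fun i => @rV_coord R n i \o f) `<=` measurable.
  apply: smallest_sub; first exact: sigma_algebra_measurable.
  rewrite -bigcup_seq; apply: bigcup_sub => i _ _ [B mB <-].
  by apply: mf.
apply: H; rewrite g_sigma_preimage_comp; exists A => //.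
by rewrite setTI.
Qed.

Section lebesgue_rV.
Context (R : realType).

Definition rV_cons n (p : measurableTypeR R * 'rV[R]_n) : 'rV[R]_n.+1 :=
  row_mx (const_mx p.1 : 'rV[R]_1) p.2.

Lemma measurable_rV_cons n : measurable_fun setT (@rV_cons n).
Proof.
apply/measurable_fun_rVP => i.
have := splitP (i : 'I_(1 + n)); case=> j ij.
- rewrite (_ : _ \o _ = fst)//; apply/funext => p.
  rewrite /rV_coord/= (_ : i = lshift n j); last exact/val_inj.
  by rewrite /rV_cons (@row_mxEl _ 1 1 n) mxE.
- rewrite (_ : _ \o _ = @rV_coord R n j \o snd).
    by apply: measurableT_comp; [exact: measurable_rV_coord|].
  apply/funext => p.
  rewrite /rV_coord/= (_ : i = rshift 1 j); last exact/val_inj.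
  by rewrite /rV_cons (@row_mxEr _ 1 1 n).
Qed.

Definition rV_uncons n (x : 'rV[R]_n.+1) : measurableTypeR R * 'rV[R]_n :=
  (x ord0 ord0, rsubmx (x : 'rV_(1 + n))).

Lemma rV_consK n : cancel (@rV_cons n) (@rV_uncons n).
Proof.
case=> a v; rewrite /rV_uncons /rV_cons (@row_mxKr _ 1 1 n); congr pair.
rewrite (_ : ord0 = lshift n (@ord0 0)); last exact/val_inj.
by rewrite (@row_mxEl _ 1 1 n) mxE.
Qed.

Lemma measurable_rV_uncons n : measurable_fun setT (@rV_uncons n).
Proof.
apply: measurable_fun_pair; first exact: (@measurable_rV_coord R n.+1 ord0).
apply/measurable_fun_rVP => i.
rewrite (_ : _ \o _ = @rV_coord R n.+1 (rshift 1 i)).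
  exact: measurable_rV_coord.
by apply/funext => x; rewrite /rV_coord /= mxE.
Qed.

(** Lebesgue measure on R^(n+1) as the product of the Lebesgue measure on R and
    of a measure [m] on R^n, transported along the identification [rV_cons]. *)
Section cons.
Local Open Scope ereal_scope.
Context n (m : {sigma_finite_measure set 'rV[R]_n -> \bar R}).

Definition cons_measure (A : set 'rV[R]_n.+1) : \bar R :=
  (@lebesgue_measure R \x m) (@rV_cons n @^-1` A).

Let mcons (A : set 'rV[R]_n.+1) : measurable A ->
  measurable (@rV_cons n @^-1` A).
Proof. by move=> mA; rewrite -[X in measurable X]setTI; exact: measurable_rV_cons. Qed.

Let cons0 : cons_measure set0 = 0.
Proof. by rewrite /cons_measure preimage_set0 measure0. Qed.

Let cons_ge0 A : 0 <= cons_measure A.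
Proof. exact: measure_ge0. Qed.

Let cons_sigma_additive : semi_sigma_additive cons_measure.
Proof.
move=> F mF tF mUF; rewrite /cons_measure preimage_bigcup.
apply: measure_semi_sigma_additive.
- by move=> k; exact: mcons.
- apply/trivIsetP => /= i j _ _ ij; rewrite -preimage_setI.
  by move/trivIsetP : tF => /(_ _ _ _ _ ij) ->//; rewrite preimage_set0.
- by rewrite -preimage_bigcup; exact: mcons.
Qed.

HB.instance Definition _ := isMeasure.Build _ _ _ cons_measure
  cons0 cons_ge0 cons_sigma_additive.

Let cons_sigma_finite : sigma_finite setT cons_measure.
Proof.
have /sigma_finiteP[F [TF ndF Foo]] := sigma_finiteT (@lebesgue_measure R).
have /sigma_finiteP[G [TG ndG Goo]] := sigma_finiteT m.
exists (fun k => @rV_uncons n @^-1` (F k `*` G k)).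
  rewrite -preimage_bigcup (_ : \bigcup_i _ = setT) ?preimage_setT//.
  rewrite -setXTT [X in X `*` _]TF [X in _ `*` X]TG.
  apply/seteqP; split=> -[x y].
    by move=> [k _ []/= ? ?]; split; exists k.
  move=> [/= [k _ Fx] [l _ Gy]]; exists (maxn k l) => //; split.
    by move: x Fx; exact/subsetPset/ndF/leq_maxl.
  by move: y Gy; exact/subsetPset/ndG/leq_maxr.
move=> k; have [mF Fk] := Foo k; have [mG Gk] := Goo k.
have mFG : measurable (F k `*` G k) by exact: measurableX.
split.
  by rewrite -[X in measurable X]setTI; exact: measurable_rV_uncons.
rewrite /cons_measure -comp_preimage (_ : _ \o _ = id).
  by rewrite preimage_id product_measure1E// lte_mul_pinfty// ge0_fin_numE.
by apply/funext => p /=; rewrite rV_consK.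
Qed.

HB.instance Definition _ := Measure_isSigmaFinite.Build _ _ _ cons_measure
  cons_sigma_finite.

End cons.

(** Lebesgue measure on R^n; on the one-point space R^0 it is the point mass. *)
Fixpoint rV_lebesgue n : {sigma_finite_measure set 'rV[R]_n -> \bar R} :=
  if n is k.+1 then cons_measure (rV_lebesgue k) else \d_(0 : 'rV[R]_0).

Lemma rV_lebesgue_box n (A : 'I_n -> set (measurableTypeR R)) :
  (forall i, measurable (A i)) ->
  rV_lebesgue n [set x : 'rV[R]_n | forall i, A i (x ord0 i)] =
    (\prod_(i < n) lebesgue_measure (A i))%E.
Proof.
elim: n A => [|n IH] A mA /=.
  rewrite big_ord0 diracE mem_set//; by case.
rewrite big_ord_recl -IH; last by move=> i; exact: mA.
set B := [set x : 'rV[R]_n | forall i, A (lift ord0 i) (x ord0 i)].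
have -> : [set x : 'rV[R]_n.+1 | forall i, A i (x ord0 i)] =
    @rV_uncons n @^-1` (A ord0 `*` B).
  apply/seteqP; split=> x /=.
    move=> h; split=> [|i]; first exact: h.
    rewrite mxE (_ : rshift 1 i = lift ord0 i) //; exact/val_inj.
  move=> [h0 h] i; have [->//|i0] := eqVneq i ord0.
  have [j ->] : exists j, i = lift ord0 j.
    by case: (unliftP ord0 i) => [j ->|/eqP]; [exists j|rewrite (negbTE i0)].
  have := h j; rewrite mxE (_ : rshift 1 j = lift ord0 j) //; exact/val_inj.
rewrite /cons_measure -comp_preimage (_ : _ \o _ = id); last first.
  by apply/funext => p /=; rewrite rV_consK.
rewrite preimage_id product_measure1E//.
rewrite (_ : B =
    \bigcap_(i in [set: 'I_n]) ((@rV_coord R n i) @^-1` (A (lift ord0 i)))).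
  apply: fin_bigcap_measurable => // i _.
  by rewrite -[X in measurable X]setTI; exact: measurable_rV_coord.
by apply/seteqP; split=> x /= h i; [move=> _; exact: h|exact: (h i)].
Qed.

End lebesgue_rV.

Section sobolev.
Context (R : realType) (n : nat).
Implicit Types (f g psi : 'rV[R]_n -> R) (G : 'rV[R]_n -> 'rV[R]_n) (p c : R).

Local Notation mu := (@rV_lebesgue R n).

Definition dotrV (x y : 'rV[R]_n) : R := \sum_(i < n) x ord0 i * y ord0 i.

Definition enorm (x : 'rV[R]_n) : R := Num.sqrt (dotrV x x).

Definition partial (i : 'I_n) f : 'rV[R]_n -> R := 'D_(delta_mx ord0 i) f.

Definition gradient f (x : 'rV[R]_n) : 'rV[R]_n := \row_i partial i f x.

Definition iter_partial (s : seq 'I_n) f : 'rV[R]_n -> R := foldr partial f s.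

(** C^oo: every iterated partial derivative exists everywhere and is
    continuous.  [derivable] is needed since ['D_v] is a total operator. *)
Definition smooth f : Prop := forall s : seq 'I_n,
  continuous (iter_partial s f) /\
  forall i x, derivable (iter_partial s f) x (delta_mx ord0 i).

(** C_0^oo *)
Definition test_function psi : Prop :=
  smooth psi /\ compact (closure [set x | psi x != 0]).

Definition Lp_loc p g : Prop :=
  measurable_fun [set: 'rV[R]_n] g /\
  forall K : set 'rV[R]_n, compact K ->
    (\int[mu]_(x in K) (`|g x| `^ p)%:E < +oo)%E.

Definition is_weak_gradient f G : Prop :=
  [/\ Lp_loc 1 f, forall i, Lp_loc 1 (fun x => G x ord0 i) &
      forall psi, test_function psi -> forall i,
        \int[mu]_x (f x * partial i psi x) =
        - \int[mu]_x (G x ord0 i * psi x)].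

(** A representative of the weak gradient, which is unique up to a null set;
    the value 0 is junk, taken only when [f] has no weak gradient. *)
Definition weak_gradient f : 'rV[R]_n -> 'rV[R]_n :=
  xget (fun=> 0) [set G | is_weak_gradient f G].

(** W^{1,p}_loc *)
Definition sobolev_loc p f : Prop :=
  Lp_loc p f /\
  exists2 G, is_weak_gradient f G & forall i, Lp_loc p (fun x => G x ord0 i).

(** |v|^(p-2) v; it vanishes at v = 0 for every p, also for p < 2. *)
Definition p_flux p (v : 'rV[R]_n) : 'rV[R]_n := (enorm v `^ (p - 2)) *: v.

Definition p_energy_form p f psi : R :=
  \int[mu]_x dotrV (p_flux p (weak_gradient f x)) (gradient psi x).

Definition weak_subsolution p f : Prop :=
  forall psi, test_function psi -> (forall x, 0 <= psi x) ->
    p_energy_form p f psi <= 0.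

Definition constant_p_tension p c f : Prop :=
  forall psi, test_function psi ->
    p_energy_form p f psi = - c * \int[mu]_x psi x.

Definition bounded_weak_derivative f : Prop :=
  exists2 C2 : R, 0 < C2 & {ae mu, forall x, enorm (weak_gradient f x) <= C2}.

End sobolev.

(* Main.v *)
Require Import Defs.
From mathcomp Require Import all_boot all_order all_algebra.
From mathcomp Require Import all_classical all_reals all_analysis.
From mathcomp Require Import measurable_realfun.
From mathcomp Require Import ring lra.

Set Implicit Arguments.
Unset Strict Implicit.
Unset Printing Implicit Defensive.

Import Order.TTheory GRing.Theory Num.Theory.
Import numFieldNormedType.Exports.

Local Open Scope classical_set_scope.
Local Open Scope ring_scope.

(** Why the theorem holds.

    The flux |G|^(p-2) G, with G the weak gradient of f, is bounded. A bounded
    field cannot have a nonzero constant divergence c: through the boundary of a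
    cube of size r it carries at most a multiple of r^(n-1), while the total
    divergence is c times a multiple of r^n ([tension_eq0]). So c = 0 and f is
    p-harmonic.

    A p-harmonic function that is bounded below is constant when p >= n, because
    R^n is then p-parabolic. Testing the equation with exp(-f) * zeta gives

      int exp(-f) |G|^p zeta = int exp(-f) |G|^(p-2) G . grad zeta

    ([energy_identity]); exp(-f) is bounded, f being bounded below. Let a(r) be
    the energy int exp(-f) |G|^p over the cube of radius r. For a cutoff zeta of
    size r the right-hand side lives in the shell between the cubes of radii r
    and 2 r, and Young's inequality with a parameter D bounds it by
    D (a(2 r) - a(r)) plus D^(1-p) times int |grad zeta|^p, a bounded multiple of
    r^(n-p), hence bounded as p >= n ([solution_shell]). Along the radii 2^k this
    inequality, for all D at once, forces a = 0 ([hole_filling]): a small D shows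
    that a is bounded, which even at p = n makes the shells lose their energy,
    and a large D then removes the remainder.
    Finally a = 0 makes the gradients of the mollifications of f vanish, so these
    are constant, and so is their limit f ([weak_solution_const]).

    The function exp(-f) * zeta is not smooth, so f is replaced by a mollification
    in it. The gradient of the mollification is G mollified, and it is multiplied
    by the flux, of which nothing but boundedness is known; strong L1 convergence
    on cubes is therefore needed ([mollify_L1_cvg]). It rests on the density of
    continuous functions in L1 of a cube and on Young's convolution inequality.
    The remaining parts build what this uses: closure properties of smooth
    functions, cutoffs and mollifiers from the flat functions t^-k exp(-1/t), and
    Borel measurability and Tonelli's theorem for the coordinatewise
    sigma-algebra of R^n. *)

(** * Closure properties of smooth functions *)

Section smooth_closure.
Context (R : realType) (n : nat).
Local Notation V := 'rV[R]_n.
Local Notation "''e_' i" := (delta_mx ord0 i : V) (at level 8, i at level 2).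

Lemma is_derive_line (f : V -> R) (x v : V) (l : R) :
  is_derive x v f l <-> is_derive (0 : R) 1 (fun h : R => f (h *: v + x)) l.
Proof.
have E : 'D_v f x = 'D_1 (fun h : R => f (h *: v + x)) (0 : R).
  rewrite /derive; set g1 := fun h => h^-1 *: _; set g2 := fun h => h^-1 *: _.
  suff -> : g1 = g2 by [].
  by rewrite funeqE /g1 /g2 => h /=; rewrite addr0 scale0r add0r [_%:A]mulr1.
have D := derivable1P f x v.
by split=> -[d e]; split; [exact: (D.1 d)|rewrite -e E|exact: (D.2 d)|rewrite -e E].
Qed.

Lemma is_derive_comp1 (phi : R -> R) (g : V -> R) (x v : V) (a b : R) :
  is_derive (g x) 1 phi a -> is_derive x v g b -> is_derive x v (phi \o g) (a * b).
Proof.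
move=> dphi /is_derive_line dg; apply/is_derive_line.
pose G (h : R) := g (h *: v + x).
rewrite (_ : (fun h => _) = phi \o G)//.
by apply: is_derive1_comp; rewrite /G scale0r add0r.
Qed.

Lemma is_derive_coord (i j : 'I_n) (x : V) :
  is_derive x 'e_i (fun y : V => y ord0 j : R) (j == i)%:R.
Proof.
apply/is_derive_line.
rewrite (_ : (fun h => _) = (fun h : R => h * (j == i)%:R + x ord0 j)); last first.
  by apply/funext => h; rewrite !mxE.
have := is_deriveD (is_deriveM (is_derive_id (0 : R) (1 : R))
  (is_derive_cst ((j == i)%:R : R) (0 : R) (1 : R)))
  (is_derive_cst (x ord0 j : R) (0 : R) (1 : R)).
by move=> D; apply: (is_derive_eq D); rewrite scaler0 add0r addr0 [LHS]mulr1.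
Qed.

Lemma is_derive_reflect (g : V -> R) (x y v : V) (l : R) :
  is_derive (x - y) v g l -> is_derive y v (fun z => g (x - z)) (- l).
Proof.
move=> /is_derive_line dg; apply/is_derive_line.
rewrite (_ : (fun h : R => _) = (fun h : R => g (h *: v + (x - y))) \o -%R).
  rewrite -mulrN1; apply: is_derive1_comp; rewrite oppr0//.
apply/funext => h /=; congr g; rewrite scaleNr opprD; exact: addrCA.
Qed.

Lemma partial_eq (f : V -> R) (i : 'I_n) (g : V -> R) :
  (forall x, is_derive x 'e_i f (g x)) -> partial i f = g.
Proof. by move=> fg; apply/funext => x; rewrite /partial; have [_ ->] := fg x. Qed.

(** Two terms on the right let one shape serve for the exponential, for the
    inverse and for the functions t^-k exp(-1/t). *)
Definition derivative_chain (J : set R) (phi : nat -> R -> R) (a b : nat -> R) :=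
  forall k t, J t ->
    is_derive t 1 (phi k) (a k * phi k.+1 t + b k * phi k.+2 t).

(** A grammar of functions that is stable under partial derivatives. *)
Inductive smooth_term : (V -> R) -> Prop :=
| st_base f of smooth f : smooth_term f
| st_cst c : smooth_term (fun=> c)
| st_coord j : smooth_term (fun x => x ord0 j)
| st_add f g of smooth_term f & smooth_term g : smooth_term (fun x => f x + g x)
| st_mul f g of smooth_term f & smooth_term g : smooth_term (fun x => f x * g x)
| st_comp J phi a b k g of derivative_chain J phi a b & (forall x, J (g x)) &
    smooth_term g : smooth_term (fun x => phi k (g x))
| st_reflect f x of smooth_term f : smooth_term (fun y => f (x - y)).

Lemma smooth_termP (f : V -> R) : smooth_term f ->
  continuous f /\ forall i, exists2 g, smooth_term g &
    forall x, is_derive x 'e_i f (g x).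
Proof.
elim=> {f}
  [f sf|c|j|f g sf [cf df] sg [cg dg]|f g sf [cf df] sg [cg dg]
  |J phi a b k g ch Jg sg [cg dg]|f x sf [cf df]].
- split=> [|i]; first by have [] := sf [::].
  exists (partial i f).
    apply: st_base => s; have := sf (rcons s i).
    by rewrite /iter_partial -cats1 foldr_cat.
  by move=> x; apply: derivableP; have [_] := sf [::]; apply.
- split=> [|i]; first exact: cst_continuous.
  by exists (fun=> 0); [exact: st_cst|move=> x; exact: is_derive_cst].
- split=> [|i]; first exact: coord_continuous.
  by exists (fun=> (j == i)%:R); [exact: st_cst|move=> x; exact: is_derive_coord].
- split=> [x|i]; first exact: cvgD (cf x) (cg x).
  have [f' sf' df'] := df i; have [g' sg' dg'] := dg i.
  exists (fun x => f' x + g' x); first exact: st_add.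
  by move=> x; exact: is_deriveD.
- split=> [x|i]; first exact: cvgM (cf x) (cg x).
  have [f' sf' df'] := df i; have [g' sg' dg'] := dg i.
  exists (fun x => f x * g' x + g x * f' x).
    by apply: st_add; exact: st_mul.
  by move=> x; exact: is_deriveM.
- split=> [x|i].
    apply: (@continuous_comp _ _ _ g (phi k)); first exact: cg.
    apply/differentiable_continuous/derivable1_diffP.
    by have [] := ch k (g x) (Jg x).
  have [g' sg' dg'] := dg i.
  exists (fun x => (a k * phi k.+1 (g x) + b k * phi k.+2 (g x)) * g' x).
    apply: st_mul => //; apply: st_add; apply: st_mul;
    first [exact: st_cst|exact: (st_comp _ ch)].
  by move=> x; exact: (is_derive_comp1 (ch k _ (Jg x)) (dg' x)).
- split=> [y|i].
    have := @continuous_comp _ _ _ (fun z : V => x - z) f y; apply; last exact: cf.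
    rewrite /prop_for /continuous_at; apply: (@cvgB R V V (nbhs y) _ (fun=> x) id).
      exact: cvg_cst.
    exact: cvg_id.
  have [f' sf' df'] := df i.
  exists (fun y => -1 * f' (x - y)).
    by apply: st_mul; [exact: st_cst|exact: st_reflect].
  by move=> y; rewrite mulN1r; exact: is_derive_reflect.
Qed.

(** Iterated partials of a term are terms, so that one induction on terms
    replaces an induction on the order of differentiation per operation. *)
Lemma smooth_term_smooth (f : V -> R) : smooth_term f -> smooth f.
Proof.
move=> sf s.
have : smooth_term (iter_partial s f).
  elim: s => [//|i s IH] /=; have [_ /(_ i)[g sg dg]] := smooth_termP IH.
  by rewrite (partial_eq dg).
move=> /smooth_termP[cf df]; split=> // i x.
by have [g _ /(_ x)[]] := df i.
Qed.

Lemma smooth_continuous (f : V -> R) : smooth f -> continuous f.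
Proof. by move=> /(_ [::])[]. Qed.

Lemma smooth_is_derive (f : V -> R) i x : smooth f -> is_derive x 'e_i f (partial i f x).
Proof. by move=> /(_ [::])[_ d]; apply: derivableP; exact: d. Qed.

Lemma smooth_partial (f : V -> R) i : smooth f -> smooth (partial i f).
Proof.
by move=> sf s; have := sf (rcons s i); rewrite /iter_partial -cats1 foldr_cat.
Qed.

Lemma smooth_coind (P : (V -> R) -> Prop) :
  (forall f, P f -> [/\ continuous f, forall i x, derivable f x 'e_i &
     forall i, P (partial i f)]) -> forall f, P f -> smooth f.
Proof.
move=> H f Pf s; have : P (iter_partial s f).
  by elim: s => [//|i s IH] /=; have [_ _] := H _ IH; apply.
by move=> /H[].
Qed.

Lemma smooth_prod (I : Type) (s : seq I) (F : I -> V -> R) :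
  (forall i, smooth (F i)) -> smooth (fun x => \prod_(i <- s) F i x).
Proof.
move=> sF; apply: smooth_term_smooth; elim: s => [|i s IH].
  under eq_fun do rewrite big_nil; exact: st_cst.
by under eq_fun do rewrite big_cons; apply: st_mul => //; exact: st_base.
Qed.

End smooth_closure.

(** * A smooth step function *)

Section step_function.
Context {R : realType}.

(** The whole family is introduced because, unlike exp(-1/t) alone, it is stable
    under differentiation up to linear combinations. *)
Definition flat (k : nat) (t : R) : R :=
  if 0 < t then t^-1 ^+ k * expR (- t^-1) else 0.

Lemma flat_ge0 k t : 0 <= flat k t.
Proof.
rewrite /flat; case: ifPn => // t0.
by rewrite mulr_ge0 ?expR_ge0// exprn_ge0// invr_ge0 ltW.
Qed.

Lemma flat_le0 k t : t <= 0 -> flat k t = 0.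
Proof. by move=> t0; rewrite /flat ltNge t0. Qed.

Lemma flat_gt0 k t : 0 < t -> 0 < flat k t.
Proof.
by move=> t0; rewrite /flat t0 mulr_gt0 ?expR_gt0// exprn_gt0// invr_gt0.
Qed.

(** The exponential series dominates each of its terms. The exponent 2 is what
    makes the derivative at 0 vanish. *)
Lemma flat_quad k t : `|flat k t| <= (k.+2)`!%:R * t ^+ 2.
Proof.
have [t0|t0] := ltP 0 t; last first.
  by rewrite flat_le0// normr0 mulr_ge0// sqr_ge0.
rewrite ger0_norm ?flat_ge0// /flat t0.
have s0 : 0 < t^-1 by rewrite invr_gt0.
have := expR_ge1Dxn k.+1 (ltW s0); set N := _`!%:R => h.
have N0 : 0 < N by rewrite ltr0n fact_gt0.
have {}h : t^-1 ^+ k.+2 / N <= expR t^-1.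
  by apply: le_trans h; rewrite lerDr.
rewrite expRN.
have h2 : t^-1 ^+ k.+2 <= N * expR t^-1 by rewrite mulrC -ler_pdivrMr.
rewrite ler_pdivrMr ?expR_gt0//.
have -> : t^-1 ^+ k = t ^+ 2 * t^-1 ^+ k.+2.
  by rewrite -(addn2 k) exprD mulrCA -exprMn mulfV ?gt_eqF// expr1n mulr1.
by rewrite -[leRHS]mulrA [leRHS]mulrCA ler_wpM2l ?sqr_ge0.
Qed.

Lemma is_derive_flat0 k : is_derive (0 : R) 1 (flat k) 0.
Proof.
suff H : h^-1 *: (flat k (h *: 1 + 0) - flat k 0) @[h --> 0^'] --> (0 : R).
  by apply: DeriveDef; [exact: (cvgP _ H)|exact: cvg_lim].
apply/cvgr0Pnorm_le => e e0.
set N : R := (k.+2)`!%:R.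
have N0 : 0 < N by rewrite ltr0n fact_gt0.
near=> h.
have h0 : h != 0 by near: h; exact: nbhs_dnbhs_neq.
rewrite /= [flat k 0]flat_le0// subr0 addr0 [_%:A]mulr1 normrZ normfV.
rewrite ler_pdivrMl ?normr_gt0//.
apply: (le_trans (flat_quad _ _)); rewrite -/N -real_normK ?num_real// expr2.
rewrite mulrCA ler_wpM2l// -ler_pdivlMl//.
near: h; apply: dnbhs0_le; by rewrite mulr_gt0// invr_gt0.
Unshelve. all: by end_near. Qed.

Lemma flat_chain :
  derivative_chain setT flat (fun k => - k%:R) (fun=> 1).
Proof.
move=> k t _; have [t0|t0|->] := ltgtP t 0.
- apply: (@near_eq_is_derive _ _ _ (cst 0)).
    near=> s; rewrite flat_le0//; apply/ltW; near: s; exact: lt_nbhsl.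
  by rewrite !flat_le0 ?ltW// !mulr0 addr0; exact: is_derive_cst.
- have tn0 : t != 0 by rewrite gt_eqF.
  apply: (@near_eq_is_derive R R R (fun s : R => s^-1 ^+ k * expR (- s^-1))).
    by near=> s; rewrite /flat ifT//; near: s; exact: lt_nbhsr.
  rewrite /flat t0.
  have dV : is_derive t 1 (fun t : R => t^-1) (- t ^- 2 *: 1).
    by apply: is_deriveV => //; exact: is_derive_id.
  have dE : is_derive t 1 (fun t : R => expR (- t^-1))
      (expR (- t^-1) * (- (- t ^- 2 *: 1))).
    exact: (@is_derive1_comp R expR (- (fun t : R => t^-1))).
  have D := is_deriveM (is_deriveX k dV) dE.
  rewrite (_ : (fun s : R => s^-1 ^+ k * _) =
    (fun t : R => t^-1) ^+ k * (fun t : R => expR (- t^-1))); last first.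
    by apply/funext => s; rewrite /= exprfctE.
  apply: (is_derive_eq D); rewrite exprfctE /GRing.scale /= -exprVn.
  set u := t^-1; case: k {D} => [|k]; rewrite ?exprS /=; first by ring.
  by ring.
- rewrite !flat_le0// !mulr0 addr0; exact: is_derive_flat0.
Unshelve. all: by end_near. Qed.

Let den t := flat 0 (1 + t) + flat 0 (1 - t).

Lemma step_den_gt0 t : 0 < den t.
Proof.
rewrite /den; have [t0|t0] := leP t 0.
  by rewrite ltr_wpDl ?flat_ge0// flat_gt0//; lra.
by rewrite ltr_pwDl ?flat_ge0// flat_gt0//; lra.
Qed.

(** A smooth step from 0 on the left of -1 to 1 on the right of 1. *)
Definition step (t : R) : R := flat 0 (1 + t) / den t.

(** The derivative of [step], written out so that its parity, its sign and its
    support can be read off. *)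
Definition hat (t : R) : R :=
  (flat 2 (1 + t) * flat 0 (1 - t) + flat 0 (1 + t) * flat 2 (1 - t)) /
  den t ^+ 2.

Lemma hat_ge0 t : 0 <= hat t.
Proof.
by rewrite /hat divr_ge0 ?sqr_ge0// addr_ge0// mulr_ge0// flat_ge0.
Qed.

Lemma hat_even t : hat (- t) = hat t.
Proof. by rewrite /hat /den opprK; congr (_ / _); ring. Qed.

Lemma hat_eq0 t : 1 <= `|t| -> hat t = 0.
Proof.
rewrite ler_normr /hat => /orP[] h.
  by rewrite !(@flat_le0 _ (1 - t)) ?mulr0 ?addr0 ?mul0r//; lra.
by rewrite !(@flat_le0 _ (1 + t)) ?mul0r ?addr0 ?mul0r//; lra.
Qed.

Lemma step_ge0 t : 0 <= step t.
Proof. by rewrite /step divr_ge0 ?flat_ge0// ltW// step_den_gt0. Qed.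

Lemma step_le1 t : step t <= 1.
Proof. by rewrite /step ler_pdivrMr ?step_den_gt0// mul1r lerDl flat_ge0. Qed.

Lemma step0 t : t <= -1 -> step t = 0.
Proof. by move=> h; rewrite /step flat_le0 ?mul0r//; lra. Qed.

Lemma step1 t : 1 <= t -> step t = 1.
Proof.
move=> h; have := step_den_gt0 t.
rewrite /step /den (@flat_le0 _ (1 - t)) ?addr0; last lra.
by move=> ?; rewrite mulfV// gt_eqF.
Qed.

Lemma is_derive_step (t : R) : is_derive t 1 step (hat t).
Proof.
have D1 : is_derive t 1 (fun t : R => 1 + t) 1.
  apply: (is_derive_eq (is_deriveD (is_derive_cst (1 : R) t (1 : R))
    (is_derive_id t (1 : R)))); exact: add0r.
have D2 : is_derive t 1 (fun t : R => 1 - t) (- 1).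
  apply: (is_derive_eq (is_deriveB (is_derive_cst (1 : R) t (1 : R))
    (is_derive_id t (1 : R)))); exact: sub0r.
have F (s : R) : is_derive s 1 (flat 0) (flat 2 s).
  apply: (is_derive_eq (@flat_chain 0 s I)).
  by rewrite oppr0 mul0r add0r mul1r.
have E1 := @is_derive1_comp R (flat 0) _ t _ _ (F (1 + t)) D1.
have E2 := @is_derive1_comp R (flat 0) _ t _ _ (F (1 - t)) D2.
have E := is_deriveM E1 (@is_deriveV _ _ _ _ _ (lt0r_neq0 (step_den_gt0 t))
  (is_deriveD E1 E2)).
apply: (is_derive_eq E); rewrite /GRing.scale /= /hat.
have := step_den_gt0 t; rewrite -/(den t).
rewrite /den; set a := flat 0 _; set b := flat 0 _ => ab.
by field; rewrite gt_eqF.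
Qed.

End step_function.

(** * Cubes, measurability and integrability in R^n *)

Section cubes.
Context (R : realType) (n : nat).
Local Notation V := 'rV[R]_n.
Local Notation mu := (@rV_lebesgue R n).

Definition cube (r : R) : set V := [set x | forall i, `|x ord0 i| <= r].

Lemma cube_le (r s : R) : r <= s -> cube r `<=` cube s.
Proof. by move=> rs x xr i; exact: le_trans (xr i) rs. Qed.

Lemma ball_rV (x y : V) (e : R) : 0 < e ->
  ball x e y <-> forall i, `|x ord0 i - y ord0 i| < e.
Proof.
move=> e0; split => [[_ h] i|h]; first exact: (h ord0 i).
by split=> // a i; rewrite ord1; exact: h.
Qed.

Lemma compact_cube (r : R) : compact (cube r).
Proof.
rewrite (_ : cube r = [set v : V | forall i, `[- r, r]%classic (v ord0 i)]).
  by apply: (@rV_compact _ _ (fun=> `[- r, r]%classic)) => _; exact: segment_compact.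
by apply/seteqP; split=> x /= h i; have := h i; rewrite /= in_itv/= ler_norml.
Qed.

Lemma compact_sub_cube (K : set V) : compact K -> exists2 r : R, 0 < r & K `<=` cube r.
Proof.
move=> /compact_bounded[M [_ MK]].
exists (`|M| + 1); first by rewrite ltr_wpDl.
move=> x Kx i; have := MK (`|M| + 1); rewrite ltr_pwDr// ?ler_norm// => /(_ isT x Kx).
apply: le_trans; rewrite [leRHS]/Num.norm/= mx_normrE.
by apply: (le_trans _ (le_bigmax _ _ (ord0, i))).
Qed.

Lemma coord_measurable (i : 'I_n) : measurable_fun [set: V] (fun x : V => x ord0 i : R).
Proof. exact: measurable_rV_coord. Qed.

Lemma box_measurable (A : 'I_n -> set R) : (forall i, measurable (A i)) ->
  measurable [set x : V | forall i, A i (x ord0 i)].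
Proof.
move=> mA; rewrite (_ : [set _ | _] =
    \bigcap_(i in [set: 'I_n]) ((fun x : V => x ord0 i : R) @^-1` (A i))).
  apply: fin_bigcap_measurable => // i _.
  by rewrite -[X in measurable X]setTI; exact: coord_measurable.
by apply/seteqP; split=> x /= h i; [move=> _; exact: h|exact: (h i)].
Qed.

Lemma measurable_cube (r : R) : measurable (cube r).
Proof.
rewrite (_ : cube r = [set x | forall i, `[- r, r]%classic (x ord0 i)]).
  by apply: (@box_measurable (fun=> `[- r, r]%classic)) => i; exact: measurable_itv.
by apply/seteqP; split=> x /= h i; have := h i; rewrite /= in_itv/= ler_norml.
Qed.
Local Hint Resolve measurable_cube : core.

Lemma rV_lebesgue_cube (r : R) : 0 <= r -> mu (cube r) = ((2 * r) ^+ n)%:E.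
Proof.
move=> r0.
rewrite (_ : cube r = [set x : V | forall i, `[- r, r]%classic (x ord0 i)]); last first.
  by apply/seteqP; split=> x /= h i; have := h i; rewrite /= in_itv/= ler_norml.
rewrite (@rV_lebesgue_box R n (fun=> `[- r, r]%classic)); last first.
  by move=> i; exact: measurable_itv.
rewrite (eq_bigr (fun=> (2 * r)%:E)); last first.
  move=> i _; rewrite lebesgue_measure_itv/= lte_fin.
  case: ltP => [_|]; first by rewrite -EFinB; congr EFin; ring.
  by move=> h; congr EFin; lra.
by rewrite prodEFin prodr_const card_ord.
Qed.

Lemma cube_finite (r : R) : (mu (cube r) < +oo)%E.
Proof.
apply: (@le_lt_trans _ _ (mu (cube `|r|))); last by rewrite rV_lebesgue_cube// ltry.
by apply: le_measure; rewrite ?inE//; apply: cube_le; exact: ler_norm.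
Qed.

(** Open sets are countable unions of boxes with rational data, so that the
    topology is compatible with the coordinatewise sigma-algebra. *)
Lemma open_measurable_rV (U : set V) : open U -> measurable U.
Proof.
move=> oU; pose box (q : 'rV[rat]_n * nat) : set V :=
  [set x | forall i, ball (ratr (q.1 ord0 i) : R) q.2.+1%:R^-1 (x ord0 i)].
rewrite (_ : U = \bigcup_q (if pselect (box q `<=` U) then box q else set0)).
  apply: countable_bigcupT_measurable => [|q]; first exact: countableP.
  case: pselect => [h|h] /=; last exact: measurable0.
  apply: (@box_measurable (fun i => ball (ratr (q.1 ord0 i) : R) q.2.+1%:R^-1)).
  by move=> i; exact: measurable_ball.
apply/seteqP; split=> [x Ux|x [q _]]; last by case: pselect => [h /h//|h []].
have /nbhs_ballP[e /= e0 he] : nbhs x U by move: oU; rewrite openE; exact.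
have [k ke] : exists k, k.+1%:R^-1 < e / 2 :> R.
  have e2 : 0 < e / 2 by rewrite divr_gt0.
  exists (Num.truncn (e / 2)^-1); rewrite invf_plt ?posrE//.
  exact: truncnS_gt.
have k0 : 0 < k.+1%:R^-1 :> R by rewrite invr_gt0.
have /choice[q hq] : forall i : 'I_n, exists q : rat,
    `|ratr q - x ord0 i| < k.+1%:R^-1.
  move=> i; have : x ord0 i - k.+1%:R^-1 < x ord0 i + k.+1%:R^-1.
    by rewrite ltrBlDr -addrA ltrDl addr_gt0.
  by move=> /rat_in_itvoo[q]; rewrite in_itv/= => hq; exists q; rewrite ltr_distl.
exists (\row_i q i, k) => //; case: pselect => [h|[]] /=.
  by move=> i /=; rewrite mxE; exact: hq.
move=> y /= hy; apply: he; apply/ball_rV => // i.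
have := hy i; have := hq i; rewrite mxE /ball/= => h1 h2.
rewrite (_ : x ord0 i - y ord0 i =
  (ratr (q i) - y ord0 i) - (ratr (q i) - x ord0 i)); last by ring.
apply: (le_lt_trans (ler_normB _ _)).
apply: (lt_trans (ltrD h2 h1)).
by rewrite [ltRHS](splitr e) ltrD.
Qed.

Lemma continuous_measurable_rV (g : V -> R) : continuous g -> measurable_fun setT g.
Proof.
move=> /continuousP cg; apply: (measurability _ (RGenOpens.measurableE R)).
move=> _ [_ [a [b ->] <-]]; rewrite setTI; apply: open_measurable_rV.
by apply: cg; exact: interval_open.
Qed.

(** The class in which the integrals over the whole space below live; it is stable
    under multiplication by locally bounded functions. *)
Definition bounded_support (g : V -> R) :=
  measurable_fun setT g /\
  exists r C : R, (forall x, `|g x| <= C) /\ (forall x, ~ cube r x -> g x = 0).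

Definition locally_bounded (g : V -> R) :=
  measurable_fun setT g /\
  forall r, exists C : R, forall x, cube r x -> `|g x| <= C.

Lemma bounded_support_integrable g : bounded_support g ->
  mu.-integrable setT (EFin \o g).
Proof.
move=> [mg [r [C [gC g0]]]].
have := @measurable_bounded_integrable _ _ _ mu g _ (measurable_cube r) (cube_finite r).
move=> /(_ (measurable_funTS mg)) H.
have /(integrable_mkcond _ (measurable_cube r)) : mu.-integrable (cube r) (EFin \o g).
  apply: H; exists C; split; first exact: num_real.
  by move=> M CM x _; apply: le_trans (gC x) (ltW CM).
apply: eq_integrable => // x _; rewrite patchE; case: ifPn => // /negP.
by rewrite inE => /g0 /= ->.
Qed.

Lemma locally_bounded_integrable g r : locally_bounded g ->
  mu.-integrable (cube r) (EFin \o g).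
Proof.
move=> [mg /(_ r)[C gC]].
apply: measurable_bounded_integrable; [by []|exact: cube_finite| |].
  exact: measurable_funTS.
exists C; split; first exact: num_real.
by move=> M CM x /gC xC; apply: le_trans xC (ltW CM).
Qed.

Lemma bounded_supportM g h : bounded_support g -> locally_bounded h ->
  bounded_support (fun x => g x * h x).
Proof.
move=> [mg [r [C [gC g0]]]] [mh /(_ r)[D hD]]; split; first exact: measurable_funM.
exists r, (C * Num.max D 0); split=> x; last by move=> /g0 ->; rewrite mul0r.
have [xr|/g0 ->] := pselect (cube r x); last first.
  rewrite mul0r normr0 mulr_ge0//; last by rewrite le_max lexx orbT.
  exact: le_trans (gC x).
rewrite normrM ler_pM//; apply: (le_trans (hD _ xr)); by rewrite le_max lexx.
Qed.

Lemma bounded_supportD g h : bounded_support g -> bounded_support h ->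
  bounded_support (fun x => g x + h x).
Proof.
move=> [mg [r [C [gC g0]]]] [mh [s [D [hD h0]]]]; split.
  exact: measurable_funD.
exists (Num.max r s), (C + D); split=> x.
  by apply: (le_trans (ler_normD _ _)); rewrite lerD.
move=> xrs; rewrite g0 ?h0 ?addr0//; apply: contra_not xrs; apply: cube_le;
by rewrite le_max lexx ?orbT.
Qed.

Lemma bounded_support0 : bounded_support (fun=> 0).
Proof.
split; first exact: measurable_cst.
by exists 0, 0; split=> // x; rewrite normr0.
Qed.

Lemma bounded_support_sum (I : Type) (s : seq I) (F : I -> V -> R) :
  (forall i, bounded_support (F i)) ->
  bounded_support (fun x => \sum_(i <- s) F i x).
Proof.
move=> bF; elim: s => [|i s IH].
  by under eq_fun do rewrite big_nil; exact: bounded_support0.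
by under eq_fun do rewrite big_cons; exact: bounded_supportD.
Qed.

Lemma locally_boundedM g h : locally_bounded g -> locally_bounded h ->
  locally_bounded (fun x => g x * h x).
Proof.
move=> [mg gC] [mh hC]; split; first exact: measurable_funM.
move=> r; have [C {}gC] := gC r; have [D {}hC] := hC r.
by exists (C * D) => x xr; rewrite normrM ler_pM// ?gC ?hC.
Qed.

Lemma locally_boundedB g h : locally_bounded g -> locally_bounded h ->
  locally_bounded (fun x => g x - h x).
Proof.
move=> [mg gC] [mh hC]; split; first exact: measurable_funB.
move=> r; have [C {}gC] := gC r; have [D {}hC] := hC r.
exists (C + D) => x xr; apply: (le_trans (ler_normB _ _)).
by rewrite lerD// ?gC ?hC.
Qed.

Lemma locally_bounded_norm g : locally_bounded g ->
  locally_bounded (fun x => `|g x|).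
Proof.
move=> [mg gC]; split; first exact: measurableT_comp.
by move=> r; have [C {}gC] := gC r; exists C => x /gC; rewrite normr_id.
Qed.

Lemma locally_bounded_sum (I : Type) (s : seq I) (F : I -> V -> R) :
  (forall i, locally_bounded (F i)) ->
  locally_bounded (fun x => \sum_(i <- s) F i x).
Proof.
move=> bF; split; first by apply: measurable_sum => i; have [] := bF i.
move=> r; have /choice[C hC] := fun i => (bF i).2 r.
exists (\sum_(i <- s) C i) => x xr; apply: (le_trans (ler_norm_sum _ _ _)).
by apply: ler_sum => i _; exact: hC.
Qed.

Lemma continuous_locally_bounded g : continuous g -> locally_bounded g.
Proof.
move=> cg; split; first exact: continuous_measurable_rV.
move=> r; have /compact_bounded[M [_ MK]] : compact (g @` cube r).
  by apply: continuous_compact (@compact_cube r); exact: continuous_subspaceT.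
exists (`|M| + 1) => x xr; apply: (MK (`|M| + 1)); last by exists x.
by rewrite ltr_pwDr// ler_norm.
Qed.

Lemma test_function_support (psi : V -> R) : test_function psi ->
  exists r : R, forall x, ~ cube r x -> psi x = 0.
Proof.
move=> [_ /compact_sub_cube[r _ sr]]; exists r => x nx.
by apply/eqP; apply: contra_notT nx => h; apply: sr; exact: subset_closure.
Qed.

Lemma continuous_bounded_support (g : V -> R) r : continuous g ->
  (forall x, ~ cube r x -> g x = 0) -> bounded_support g.
Proof.
move=> /continuous_locally_bounded[mg /(_ r)[C gC]] g0; split=> //.
exists r, (Num.max C 0); split=> // x; rewrite le_max.
by have [/gC ->//|/g0 ->] := pselect (cube r x); rewrite normr0 lexx orbT.
Qed.

Lemma test_functionI (psi : V -> R) r : smooth psi ->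
  (forall x, ~ cube r x -> psi x = 0) -> test_function psi.
Proof.
move=> sp p0; split=> //.
apply: (@subclosed_compact _ _ (cube r)); [exact: closed_closure|exact: compact_cube|].
have cl : closed (cube r).
  apply: compact_closed; [exact: norm_hausdorff|exact: compact_cube].
rewrite ((closure_id (cube r)).1 cl); apply: closureS => x /= px.
by apply: contrapT => /p0 p0x; rewrite p0x eqxx in px.
Qed.

End cubes.

(** * Integrals of products over the coordinates *)

Section hat_integral.
Context {R : realType}.
Implicit Types (a e t : R).

Lemma flat_continuous k : continuous (@flat R k).
Proof.
move=> t; apply/differentiable_continuous/derivable1_diffP.
by have [] := @flat_chain R k t I.
Qed.

Lemma hat_continuous : continuous (@hat R).
Proof.
move=> t; have F k : flat k (1 + s) @[s --> t] --> flat k (1 + t).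
  apply: (@continuous_comp R R R (fun s => 1 + s)); last exact: flat_continuous.
  by apply: cvgD; [exact: cvg_cst|exact: cvg_id].
have G k : flat k (1 - s) @[s --> t] --> flat k (1 - t).
  apply: (@continuous_comp R R R (fun s => 1 - s)); last exact: flat_continuous.
  by apply: cvgB; [exact: cvg_cst|exact: cvg_id].
apply: cvgM; first by apply: cvgD; apply: cvgM.
apply: cvgV; first by rewrite expf_neq0// gt_eqF// step_den_gt0.
apply: (@cvgM R _ _ _ (fun s => flat 0 (1 + s) + flat 0 (1 - s))
  (fun s => flat 0 (1 + s) + flat 0 (1 - s))); exact: cvgD.
Qed.

Let scaled_hat a e t := hat ((a - t) / e) / e.

Lemma scaled_hat_continuous a e : continuous (scaled_hat a e).
Proof.
move=> t; apply: cvgM; last exact: cvg_cst.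
apply: (@continuous_comp R R R (fun s => (a - s) / e)); last exact: hat_continuous.
apply: cvgM; last exact: cvg_cst.
by apply: cvgB; [exact: cvg_cst|exact: cvg_id].
Qed.

(** The total mass of a hat is the increment of the step function. *)
Lemma integral_scaled_hat a e : 0 < e ->
  (\int[lebesgue_measure]_t (scaled_hat a e t)%:E = 1)%E.
Proof.
move=> e0; pose F t : R := - step ((a - t) / e).
have dF (t : R) : is_derive t 1 F (scaled_hat a e t).
  have L : is_derive t 1 (fun t => (a - t) / e) (- e^-1).
    have D := is_deriveM (is_deriveB (is_derive_cst a t (1 : R))
      (is_derive_id t (1 : R))) (is_derive_cst e^-1 t (1 : R)).
    by apply: (is_derive_eq D); rewrite /GRing.scale /=; ring.
  have D := is_deriveN (@is_derive1_comp R (@step R) _ t _ _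
    (is_derive_step ((a - t) / e)) L).
  by apply: (is_derive_eq D); rewrite /scaled_hat; ring.
have cF : continuous F.
  by move=> t; apply/differentiable_continuous/derivable1_diffP; have [] := dF t.
rewrite (_ : (fun t => _) =
    (fun t => (scaled_hat a e t)%:E) \_ `[a - e, a + e]); last first.
  apply/funext => t; rewrite patchE; case: ifPn => // /negP.
  rewrite inE /= in_itv/= => h; rewrite /scaled_hat hat_eq0 ?mul0r//.
  rewrite normrM normfV (gtr0_norm e0) ler_pdivlMr// mul1r ler_normr.
  move/negP: h; rewrite negb_and -!ltNge => /orP[] h; apply/orP; [left|right];lra.
rewrite -integral_mkcond (@continuous_FTC2 _ _ F); last 4 first.
- by lra.
- exact/continuous_subspaceT/scaled_hat_continuous.
- split=> [t _||]; first by have [] := dF t.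
    exact/cvg_at_right_filter/cF.
  exact/cvg_at_left_filter/cF.
- by move=> t _; rewrite derive1E; have [_ ->] := dF t.
rewrite /F -EFinB; congr EFin.
rewrite opprK step0; last first.
  by rewrite opprD addrA subrr sub0r mulNr divff// gt_eqF.
by rewrite step1 ?oppr0 ?add0r// opprB addrC subrK divff// gt_eqF.
Qed.

End hat_integral.

Section product_integral.
Context (R : realType).

Lemma rV_cons0 n (t : R) (y : 'rV[R]_n) : rV_cons (t, y) ord0 ord0 = t.
Proof. by case: (rV_consK (t : measurableTypeR R, y)). Qed.

Lemma rV_cons_lift n (t : R) (y : 'rV[R]_n) i :
  rV_cons (t, y) ord0 (lift ord0 i) = y ord0 i.
Proof.
have [_ /rowP/(_ i)] := rV_consK (t : measurableTypeR R, y).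
by rewrite mxE (_ : rshift 1 i = lift ord0 i) //; exact/val_inj.
Qed.

Local Open Scope ereal_scope.

(** Tonelli's theorem for the recursive construction of the measure. *)
Lemma ge0_integral_cons n (g : 'rV[R]_n.+1 -> \bar R) :
  measurable_fun setT g -> (forall x, 0 <= g x) ->
  \int[rV_lebesgue R n.+1]_x g x =
  \int[lebesgue_measure]_t \int[rV_lebesgue R n]_y g (rV_cons (t, y)).
Proof.
move=> mg g0.
have mc := @measurable_rV_cons R n.
rewrite -(@fubini_tonelli1 _ _ _ _ _ _ _ (fun z => g (rV_cons z)))//; last first.
  exact: measurableT_comp.
have := @ge0_integral_pushforward _ _ _ _ R _ mc
  (@lebesgue_measure R \x rV_lebesgue R n) setT g measurableT mg (fun y _ => g0 y).
rewrite preimage_setT => <-.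
by apply: eq_measure_integral => A mA _.
Qed.

Lemma integral_prod_coord n (F : 'I_n -> R -> R) :
  (forall i, measurable_fun setT (F i)) -> (forall i t, 0 <= F i t)%R ->
  \int[rV_lebesgue R n]_x (\prod_(i < n) F i (x ord0 i))%:E =
  \prod_(i < n) \int[lebesgue_measure]_t (F i t)%:E.
Proof.
elim: n F => [|n IH] F mF F0.
  rewrite big_ord0 /= (eq_integral (fun=> 1)); last by move=> x _; rewrite big_ord0.
  by rewrite integral_cst// mul1e; exact: diracT.
rewrite big_ord_recl ge0_integral_cons; last 2 first.
- apply/measurable_EFinP; apply: measurable_prod => i _.
  by apply: measurableT_comp; [exact: mF|exact: coord_measurable].
- by move=> x; rewrite lee_fin prodr_ge0.
set C := (\prod_(i < n) _)%E.
have C0 : 0 <= C.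
  apply: (big_ind (fun x => 0 <= x)) => // [|i _]; first exact: mule_ge0.
  by apply: integral_ge0 => t _; rewrite lee_fin.
rewrite -ge0_integralZr//; last 2 first.
- by apply/measurable_EFinP; exact: mF.
- by move=> t _; rewrite lee_fin.
apply: eq_integral => t _; rewrite /C -(IH (fun i => F (lift ord0 i)))//.
rewrite -ge0_integralZl//; last 3 first.
- apply/measurable_EFinP; apply: measurable_prod => i _.
  by apply: measurableT_comp; [exact: mF|exact: coord_measurable].
- by move=> y _; rewrite lee_fin prodr_ge0.
- by rewrite lee_fin.
apply: eq_integral => y _; rewrite big_ord_recl EFinM rV_cons0.
by under eq_bigr => i _ do rewrite rV_cons_lift.
Qed.

End product_integral.

(** * Lipschitz bounds, smooth functions and mollifiers *)

Section lipschitz.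
Context (R : realType) (n : nat).
Local Notation V := 'rV[R]_n.
Local Notation "''e_' i" := (delta_mx ord0 i : V) (at level 8, i at level 2).

Lemma is_derive_line_at (g : V -> R) (z v : V) (l s : R) :
  is_derive (s *: v + z) v g l -> is_derive s 1 (fun h : R => g (h *: v + z)) l.
Proof.
move=> /is_derive_line D.
have D2 : is_derive s 1 (fun u : R => u - s) (1 : R).
  by apply: (is_derive_eq (is_deriveB (is_derive_id s (1 : R))
    (is_derive_cst s s (1 : R)))); rewrite subr0.
rewrite (_ : (fun h => _) =
    (fun h : R => g (h *: v + (s *: v + z))) \o (fun u => u - s)); last first.
  by apply/funext => u /=; rewrite addrA -scalerDl subrK.
rewrite -[l]mulr1; apply: is_derive1_comp; by rewrite subrr.
Qed.

Lemma partial_line_le (g : V -> R) (i : 'I_n) (C : R) (z : V) (t : R) :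
  (forall x, derivable g x 'e_i) -> (forall x, `|partial i g x| <= C) ->
  `|g (t *: 'e_i + z) - g z| <= C * `|t|.
Proof.
move=> dg gC; pose F h := g (h *: 'e_i + z).
have dF (s : R) : is_derive s 1 F (partial i g (s *: 'e_i + z)).
  by apply: is_derive_line_at; exact: derivableP.
have cF : continuous F.
  by move=> s; apply/differentiable_continuous/derivable1_diffP; have [] := dF s.
have -> : g z = F 0 by rewrite /F scale0r add0r.
rewrite -/(F t); have [t0|t0] := leP 0 t.
  have [|c _ ->] := MVT_segment t0 (fun x _ => dF x); last first.
    by rewrite subr0 normrM ler_wpM2r// gC.
  exact: continuous_subspaceT.
have [|c _] := MVT_segment (ltW t0) (fun x _ => dF x).
  exact: continuous_subspaceT.
rewrite distrC => ->; rewrite sub0r normrM normrN ler_wpM2r//; exact: gC.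
Qed.

(** Moving one coordinate at a time turns bounds on the partial derivatives into a
    Lipschitz bound. It serves twice: for the uniform continuity of kernels, and
    with [C = 0] for the constancy of functions with zero gradient. *)
Lemma lipschitz_partials (g : V -> R) (C : R) (a b : V) :
  (forall i x, derivable g x 'e_i) -> (forall i x, `|partial i g x| <= C) ->
  `|g a - g b| <= C * \sum_i `|a ord0 i - b ord0 i|.
Proof.
move=> dg gC.
(* the coordinates of b are replaced by those of a one at a time *)
pose z m : V := \row_i if (i < m)%N then a ord0 i else b ord0 i.
have za : a = z n by apply/rowP => i; rewrite mxE ltn_ord.
have zb : b = z 0 by apply/rowP => i; rewrite mxE.
have step m (mn : (m <= n)%N) :
    `|g (z m) - g (z 0)| <= C * \sum_(i < n | (i < m)%N) `|a ord0 i - b ord0 i|.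
  elim: m mn => [|m IH] mn; first by rewrite subrr normr0 big1 ?mulr0.
  pose i := Ordinal mn.
  have zS : z m.+1 = (a ord0 i - b ord0 i) *: 'e_i + z m.
    apply/rowP => j; rewrite !mxE eqxx/= ltnS leq_eqVlt.
    have [->|ji] := eqVneq j i; first by rewrite /= eqxx ltnn /= mulr1 subrK.
    rewrite mulr0 add0r (_ : (j == m :> nat) = false)//.
    by apply/negbTE; apply: contra ji => /eqP jm; apply/eqP/val_inj.
  rewrite (bigD1 i)//= mulrDr.
  rewrite (_ : g (z m.+1) - _ = (g (z m.+1) - g (z m)) + (g (z m) - g (z 0)));
    last by rewrite addrA subrK.
  apply: (le_trans (ler_normD _ _)); apply: lerD.
    by rewrite zS; apply: partial_line_le; [exact: dg|exact: gC].
  rewrite (eq_bigl (fun j : 'I_n => (j < m)%N)); first exact/IH/ltnW.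
  move=> j /=; rewrite ltnS leq_eqVlt.
  have [->|ji] := eqVneq j i; first by rewrite /= ltnn andbF.
  rewrite andbT (_ : (j == m :> nat) = false)//.
  by apply/negbTE; apply: contra ji => /eqP jm; apply/eqP/val_inj.
have := step n (leqnn n); rewrite -za -zb.
by rewrite (eq_bigl predT)// => i; rewrite ltn_ord.
Qed.

Lemma smooth_const (g : V -> R) : smooth g -> (forall i x, partial i g x = 0) ->
  forall a b, g a = g b.
Proof.
move=> sg g0 a b; apply/eqP; rewrite -subr_eq0 -normr_le0.
have := @lipschitz_partials g 0 a b; rewrite mul0r; apply.
  by move=> i x; have [] := smooth_is_derive i x sg.
by move=> i x; rewrite g0 normr0.
Qed.

End lipschitz.

Section smooth_examples.
Context (R : realType) (n : nat).
Local Notation V := 'rV[R]_n.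

Lemma smooth_affine (a b : R) (i : 'I_n) :
  smooth_term (fun x : V => a * x ord0 i + b).
Proof.
by apply: st_add; [apply: st_mul; [exact: st_cst|exact: st_coord]|exact: st_cst].
Qed.

Lemma inv_chain : derivative_chain [set t : R | t != 0]
  (fun k t => t^-1 ^+ k.+1) (fun k => - k.+1%:R) (fun=> 0).
Proof.
move=> k t /= t0.
have D := is_deriveX k.+1 (is_deriveV t0 (is_derive_id t (1 : R))).
rewrite (_ : (fun t : R => _) = (fun t : R => t^-1) ^+ k.+1); last first.
  by apply/funext => s; rewrite exprfctE.
apply: (is_derive_eq D); rewrite /GRing.scale /= -exprVn; set u := t^-1.
by rewrite !exprS; ring.
Qed.

Lemma expN_chain : derivative_chain setT
  (fun k (t : R) => (-1) ^+ k * expR (- t)) (fun=> 1) (fun=> 0).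
Proof.
move=> k t _.
have D := is_deriveM (is_derive_cst ((-1) ^+ k : R) t (1 : R))
  (@is_derive1_comp R expR (-%R) t _ _ (is_derive_expR (- t)) (is_deriveNid t 1)).
apply: (is_derive_eq D); rewrite /GRing.scale /= exprS; ring.
Qed.

Lemma smooth_expN (g : V -> R) : smooth g -> smooth (fun x => expR (- g x)).
Proof.
move=> sg; apply: smooth_term_smooth.
rewrite (_ : (fun x => _) = (fun x => (-1) ^+ 0 * expR (- g x))); last first.
  by apply/funext => x; rewrite mul1r.
by apply: (@st_comp _ _ setT (fun k t => (-1) ^+ k * expR (- t)) _ _ 0 g
  expN_chain) => //; exact: st_base.
Qed.

Lemma smoothM (f g : V -> R) : smooth f -> smooth g -> smooth (fun x => f x * g x).
Proof. by move=> sf sg; apply: smooth_term_smooth; apply: st_mul; exact: st_base. Qed.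

Lemma smooth_reflect (g : V -> R) x : smooth g -> smooth (fun y => g (x - y)).
Proof. by move=> sg; apply: smooth_term_smooth; apply: st_reflect; exact: st_base. Qed.

Let smooth_flat k (a b : R) (i : 'I_n) :
  smooth_term (fun x : V => flat k (a * x ord0 i + b)).
Proof. by apply: (st_comp _ (@flat_chain R)) => //; exact: smooth_affine. Qed.

Let smooth_step_den k (a b : R) (i : 'I_n) :
  smooth_term (fun x : V => (flat 0 (1 + (a * x ord0 i + b)) +
    flat 0 (1 - (a * x ord0 i + b)))^-1 ^+ k.+1).
Proof.
apply: (@st_comp _ _ _ (fun k t => t^-1 ^+ k.+1) _ _ k
  (fun x : V => flat 0 (1 + (a * x ord0 i + b)) +
    flat 0 (1 - (a * x ord0 i + b))) inv_chain).
  by move=> x; rewrite /= gt_eqF// step_den_gt0.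
apply: st_add.
  by under eq_fun do rewrite addrCA; exact: smooth_flat.
under eq_fun do rewrite opprD addrCA -mulNr; exact: smooth_flat.
Qed.

Lemma smooth_step (a b : R) (i : 'I_n) :
  smooth (fun x : V => step (a * x ord0 i + b)).
Proof.
apply: smooth_term_smooth; apply: st_mul; last exact: (smooth_step_den 0).
by under eq_fun do rewrite addrCA; exact: smooth_flat.
Qed.

Lemma smooth_hat (a b : R) (i : 'I_n) :
  smooth (fun x : V => hat (a * x ord0 i + b)).
Proof.
have fP k : smooth_term (fun x : V => flat k (1 + (a * x ord0 i + b))).
  by under eq_fun do rewrite addrCA; exact: smooth_flat.
have fN k : smooth_term (fun x : V => flat k (1 - (a * x ord0 i + b))).
  by under eq_fun do rewrite opprD addrCA -mulNr; exact: smooth_flat.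
apply: smooth_term_smooth; apply: st_mul; first by apply: st_add; exact: st_mul.
by under eq_fun do rewrite -exprVn; exact: (smooth_step_den 1).
Qed.

End smooth_examples.

Section kernel.
Context (R : realType) (n : nat).
Local Notation V := 'rV[R]_n.
Local Notation mu := (@rV_lebesgue R n).

(** A product kernel, so that its mass is computed one coordinate at a time. *)
Definition mollifier (e : R) (z : V) : R := \prod_(i < n) (hat (z ord0 i / e) / e).

Lemma mollifier_ge0 e z : 0 < e -> 0 <= mollifier e z.
Proof.
by move=> e0; apply: prodr_ge0 => i _; rewrite divr_ge0 ?hat_ge0// ltW.
Qed.

Lemma mollifierC e x y : mollifier e (x - y) = mollifier e (y - x).
Proof.
apply: eq_bigr => i _; rewrite !mxE -(opprB (y ord0 i)) mulNr hat_even//.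
Qed.

Lemma mollifier_support e z : 0 < e -> ~ cube e z -> mollifier e z = 0.
Proof.
move=> e0 /existsNP[i /negP]; rewrite -ltNge => zi.
rewrite /mollifier (bigD1 i)//= hat_eq0 ?mul0r//.
by rewrite normrM normfV (gtr0_norm e0) ler_pdivlMr// mul1r ltW.
Qed.

Lemma smooth_mollifier e : smooth (mollifier e).
Proof.
apply: smooth_prod => i; apply: smoothM.
  under eq_fun do rewrite mulrC -[_ * _]addr0; exact: smooth_hat.
by apply: smooth_term_smooth; exact: st_cst.
Qed.

Lemma test_mollifier e : 0 < e -> test_function (mollifier e).
Proof.
move=> e0; apply: (@test_functionI _ _ _ e); first exact: smooth_mollifier.
by move=> x; exact: mollifier_support.
Qed.

Lemma integral_mollifier e x : 0 < e ->
  (\int[mu]_y (mollifier e (x - y))%:E = 1)%E.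
Proof.
move=> e0; rewrite /mollifier.
under eq_integral => y _ do under eq_bigr => i _ do rewrite !mxE.
rewrite (@integral_prod_coord _ _ (fun i t => hat ((x ord0 i - t) / e) / e)).
- by rewrite big1// => i _; exact: integral_scaled_hat.
- by move=> i; apply: continuous_measurable_fun; exact: scaled_hat_continuous.
- by move=> i t; rewrite divr_ge0 ?hat_ge0// ltW.
Qed.

End kernel.

(** * Convolution with a test function *)

Section convolution.
Context (R : realType) (n : nat).
Local Notation V := 'rV[R]_n.
Local Notation mu := (@rV_lebesgue R n).
Local Notation "''e_' i" := (delta_mx ord0 i : V) (at level 8, i at level 2).
Implicit Types (u k g : V -> R) (x y z : V).

Lemma cubeD r s x y : cube r x -> cube s y -> cube (r + s) (x + y).
Proof.
by move=> xr ys i; rewrite !mxE; apply: (le_trans (ler_normD _ _)); rewrite lerD.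
Qed.

Lemma cubeN r x : cube r x -> cube r (- x).
Proof. by move=> xr i; rewrite mxE normrN. Qed.

Lemma cube_exists x : exists2 r : R, 0 < r & cube r x.
Proof.
have [r r0 xr] := compact_sub_cube (@compact_set1 _ x).
by exists r => //; exact: xr.
Qed.

Lemma closed_cube r : closed (@cube R n r).
Proof. by apply: compact_closed; [exact: norm_hausdorff|exact: compact_cube]. Qed.

Lemma partial_support (k : V -> R) r i : (forall x, ~ cube r x -> k x = 0) ->
  forall x, ~ cube r x -> partial i k x = 0.
Proof.
move=> k0 x xr; rewrite /partial (@near_eq_derive _ _ _ k (cst 0)) ?derive_cst//.
have oC : open (~` (@cube R n r)) by apply: closed_openC; exact: closed_cube.
have : nbhs x (~` cube r) by move: oC; rewrite openE; apply.
by apply: filterS => y /k0.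
Qed.

Lemma test_partial k i : test_function k -> test_function (partial i k).
Proof.
move=> tk; have [r k0] := test_function_support tk.
apply: (@test_functionI _ _ _ r); first by apply: smooth_partial; exact: tk.1.
exact: partial_support.
Qed.

Lemma test_bounded_support k : test_function k -> bounded_support k.
Proof.
move=> tk; have [r k0] := test_function_support tk.
apply: continuous_bounded_support k0; exact/smooth_continuous/tk.1.
Qed.

Lemma test_bounded k : test_function k -> exists C : R, forall x, `|k x| <= C.
Proof. by move=> /test_bounded_support[_ [_ [C [kC _]]]]; exists C. Qed.

Lemma test_reflect k x : test_function k -> test_function (fun y => k (x - y)).
Proof.
move=> tk; have [r k0] := test_function_support tk; have [s s0 xs] := cube_exists x.
apply: (@test_functionI _ _ _ (s + r)); first exact/smooth_reflect/tk.1.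
move=> y yr; apply: k0; apply: contra_not yr => h.
by rewrite -(subKr x y); apply: cubeD => //; exact: cubeN.
Qed.

Lemma Rintegral_cube_bound g r C : 0 <= r -> measurable_fun setT g ->
  (forall x, cube r x -> `|g x| <= C) -> (forall x, ~ cube r x -> g x = 0) ->
  `|\int[mu]_x g x| <= C * (2 * r) ^+ n.
Proof.
move=> r0 mg gC g0.
have lg : mu.-integrable (cube r) (EFin \o g).
  apply: measurable_bounded_integrable; [exact: measurable_cube|exact: cube_finite| |].
    exact: measurable_funTS.
  exists C; split; first exact: num_real.
  by move=> M CM x xr; apply: le_trans (gC x xr) (ltW CM).
have -> : \int[mu]_x g x = \int[mu]_(x in cube r) g x.
  rewrite [RHS]Rintegral_mkcond; congr (Rintegral _ _ _); apply/funext => x.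
  by rewrite patchE; case: ifPn => // /negP; rewrite inE => /g0.
apply: (le_trans (le_normr_Rintegral _ lg)); first exact: measurable_cube.
rewrite (_ : (2 * r) ^+ n = fine (mu (cube r))); last by rewrite rV_lebesgue_cube.
rewrite -Rintegral_cst; last exact: measurable_cube.
apply: le_Rintegral => //; first exact: measurable_cube.
- exact: integrable_norm.
- by apply: locally_bounded_integrable; apply: continuous_locally_bounded; exact: cst_continuous.
Qed.

Definition conv u k x : R := \int[mu]_y (u y * k (x - y)).

Lemma conv_support k r s x y : (forall x, ~ cube r x -> k x = 0) ->
  cube s x -> ~ cube (s + r) y -> k (x - y) = 0.
Proof.
move=> k0 xs ysr; apply: k0; apply: contra_not ysr => h.
by rewrite -(subKr x y); apply: cubeD => //; exact: cubeN.
Qed.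

Lemma conv_integrand u k x : locally_bounded u -> test_function k ->
  bounded_support (fun y => u y * k (x - y)).
Proof.
move=> lu tk; under eq_fun do rewrite mulrC.
by apply: bounded_supportM => //; apply: test_bounded_support; exact: test_reflect.
Qed.

Lemma conv_integrable u k x : locally_bounded u -> test_function k ->
  mu.-integrable setT (EFin \o (fun y => u y * k (x - y))).
Proof. by move=> lu tk; apply: bounded_support_integrable; exact: conv_integrand. Qed.

(** Translates of a Lipschitz kernel differ little, uniformly. *)
Lemma conv_continuous u k : locally_bounded u -> test_function k ->
  continuous (conv u k).
Proof.
move=> lu tk; have [r k0] := test_function_support tk.
suff main (x0 : V) : conv u k x @[x --> x0] --> conv u k x0 by move=> x0; exact: main.
have [s s0 xs] := cube_exists x0.
have /choice[L kL] : forall i, exists C : R, forall x, `|partial i k x| <= C.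
  by move=> i; apply: test_bounded; exact: test_partial.
pose M : R := \sum_i `|L i|.
have kM i x : `|partial i k x| <= M.
  apply: (le_trans (kL i x)); apply: (le_trans (ler_norm _)).
  by rewrite /M (bigD1 i)//= lerDl sumr_ge0.
have M0 : 0 <= M by apply: sumr_ge0.
pose t : R := `|s + 1 + r|.
have t0 : 0 <= t by rewrite /t normr_ge0.
have [C uC] := lu.2 t.
have bound x : cube (s + 1) x ->
    `|conv u k x0 - conv u k x| <=
    `|C| * (M * \sum_i `|x0 ord0 i - x ord0 i|) * (2 * t) ^+ n.
  move=> xs1; rewrite /conv -RintegralB//; [|exact: conv_integrable|exact: conv_integrable].
  have xs' : cube (s + 1) x0 by apply: cube_le xs; rewrite lerDl.
  apply: Rintegral_cube_bound => //.
  - apply: measurable_funB; first exact: (conv_integrand x0 lu tk).1.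
    exact: (conv_integrand x lu tk).1.
  - move=> y yt; rewrite -mulrBr normrM; apply: ler_pM => //.
      by apply: (le_trans (uC y yt)); exact: ler_norm.
    have := @lipschitz_partials R n k M (x0 - y) (x - y) _ kM.
    rewrite (eq_bigr (fun i => `|x0 ord0 i - x ord0 i|)); last first.
      by move=> i _; rewrite !mxE; congr (`|_|); ring.
    apply; move=> i z; by have [] := smooth_is_derive i z tk.1.
  - move=> y yt; have yt' : ~ cube (s + 1 + r) y.
      by apply: contra_not yt; apply: cube_le; exact: ler_norm.
    by rewrite !(conv_support k0 _ yt') ?mulr0 ?subrr.
apply/(@cvgrPdist_le R R V (nbhs x0) (nbhs_filter x0)) => e e0.
pose K := `|C| * (M * n%:R) * (2 * t) ^+ n + 1.
have K0 : 0 < K.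
  by rewrite /K ltr_wpDl// mulr_ge0 ?exprn_ge0// ?mulr_ge0.
have d0 : 0 < Num.min 1 (e / K) by rewrite lt_min ltr01 divr_gt0.
apply/nbhs_ballP; exists (Num.min 1 (e / K)) => // x /(ball_rV _ _ d0) xd /=.
have xs1 : cube (s + 1) x.
  move=> i; rewrite (_ : x ord0 i = x0 ord0 i - (x0 ord0 i - x ord0 i)); last by ring.
  apply: (le_trans (ler_normB _ _)); apply: lerD; first exact: xs.
  by have := xd i; rewrite lt_min => /andP[/ltW].
apply: (le_trans (bound x xs1)).
apply: (@le_trans _ _ (`|C| * (M * (n%:R * (e / K))) * (2 * t) ^+ n)).
  rewrite ler_wpM2r ?exprn_ge0// ?mulr_ge0// ler_wpM2l// ler_wpM2l//.
  rewrite -[X in X%:R * _](card_ord n) mulr_natl -sumr_const; apply: ler_sum => i _.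
  by have := xd i; rewrite lt_min => /andP[_ /ltW].
rewrite (_ : _ * _ * _ = (K - 1) * (e / K)); last by rewrite /K; ring.
by rewrite mulrCA ger_pMr// ler_pdivrMr// mul1r gerBl.
Qed.

(** The derivative falls on the kernel, whose partial derivatives are bounded with
    bounded support; this dominates the difference quotients. *)
Lemma conv_derive u k i x : locally_bounded u -> test_function k ->
  is_derive x 'e_i (conv u k) (conv u (partial i k) x).
Proof.
move=> lu tk; apply/is_derive_line.
have [r k0] := test_function_support tk.
have [s s0 xs] := cube_exists x.
have tpk := test_partial i tk.
have [C kC] := test_bounded tpk.
pose f (t : R) (y : V) : R := u y * k (t *: 'e_i + x - y).
have df (t : R) y : is_derive t 1 (f ^~ y) (u y * partial i k (t *: 'e_i + x - y)).
  have D : is_derive t 1 (fun h : R => k (h *: 'e_i + (x - y)))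
      (partial i k (t *: 'e_i + (x - y))).
    by apply: is_derive_line_at; exact: (smooth_is_derive _ _ tk.1).
  have E := is_deriveM (is_derive_cst (u y) t (1 : R)) D.
  rewrite (_ : f ^~ y = (cst (u y) : R -> R) *
    (fun h : R => k (h *: 'e_i + (x - y)))); last first.
    by apply/funext => h; rewrite /f -addrA.
  apply: (is_derive_eq E).
  by rewrite scaler0 addr0 addrA.
pose Q := @cube R n (s + 1 + r).
pose G (y : V) : R := `|u y| * `|C| * \1_Q y.
have mQ : measurable Q by exact: measurable_cube.
have intG : mu.-integrable setT (EFin \o G).
  apply: bounded_support_integrable.
  have -> : G = (fun y => (`|C| * \1_Q y) * `|u y|) by apply/funext => y; rewrite /G; ring.
  apply: bounded_supportM; last exact: locally_bounded_norm.
  split; first by apply: measurable_funM => //; exact: measurable_indic.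
  exists (s + 1 + r), `|C|; split=> y.
    by rewrite normrM normr_id ler_piMr// indicE; case: (_ \in _); rewrite ?normr1 ?normr0.
  by move=> yQ; rewrite indicE memNset// mulr0.
have I0 : [set` `]-1, 1[%R] (0 : R) by rewrite /= in_itv/= ltrN10 ltr01.
have intf t : [set` `]-1, 1[%R] t -> mu.-integrable setT (EFin \o f t).
  by move=> _; exact: conv_integrable.
have derf t y : [set` `]-1, 1[%R] t -> setT y -> derivable (f ^~ y) t 1.
  by move=> _ _; have [] := df t y.
have G0 y : 0 <= G y by rewrite /G !mulr_ge0// indicE.
have dE t y : partial1of2 f t y = u y * partial i k (t *: 'e_i + x - y).
  by rewrite partial1of2E; have [_ ->] := df t y.
have Gub t y : [set` `]-1, 1[%R] t -> setT y -> `|partial1of2 f t y| <= G y.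
  move=> /=; rewrite in_itv/= => /andP[t1 t2] _; rewrite dE /G normrM -mulrA.
  rewrite ler_wpM2l// indicE; have [yQ|yQ] := pselect (Q y).
    by rewrite mem_set// mulr1; apply: (le_trans (kC _)); exact: ler_norm.
  rewrite (@conv_support (partial i k) r (s + 1) (t *: 'e_i + x) y)//.
  - by rewrite normr0 mulr_ge0.
  - exact: partial_support.
  - rewrite addrC; apply: cubeD => // j; rewrite !mxE eqxx /=.
    apply: (@le_trans _ _ `|t|); last by rewrite ler_norml !ltW.
    by rewrite normrM ler_piMr//; case: (_ == _); rewrite ?normr1 ?normr0.
have D := @derivable_under_integral R _ _ mu f setT measurableT 0 (-1) 1 I0 intf
  derf G G0 intG Gub.
have E := @differentiation_under_integral R _ _ mu f setT measurableT 0 (-1) 1 I0 intf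
  derf G G0 intG Gub.
split; first exact: D.
rewrite -derive1E E /conv; congr (Rintegral _ _ _); apply/funext => y.
by rewrite dE scale0r add0r.
Qed.

Lemma smooth_conv u k : locally_bounded u -> test_function k -> smooth (conv u k).
Proof.
move=> lu tk.
apply: (@smooth_coind R n [set g | exists2 k, test_function k & g = conv u k]); last first.
  by exists k.
move=> _ [{tk}k tk ->]; split; first exact: conv_continuous.
- by move=> i x; have [] := conv_derive i x lu tk.
- move=> i; exists (partial i k); first exact: test_partial.
  by apply: partial_eq => x; exact: conv_derive.
Qed.

(** The reflected kernel is a test function for the weak gradient. *)
Lemma partial_conv (f : V -> R) (G : V -> V) k (i : 'I_n) : continuous f ->
  (forall psi : V -> R, test_function psi -> forall i,
    \int[mu]_x (f x * partial i psi x) = - \int[mu]_x (G x ord0 i * psi x)) ->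
  test_function k -> partial i (conv f k) = conv (fun y => G y ord0 i) k.
Proof.
move=> /continuous_locally_bounded lf fG tk; apply/funext => x.
rewrite (partial_eq (fun x => conv_derive i x lf tk)).
rewrite /conv; apply: oppr_inj; rewrite -(fG _ (test_reflect x tk)).
have -> : partial i (fun y => k (x - y)) = fun y => - partial i k (x - y).
  apply: partial_eq => y; apply: is_derive_reflect; exact: (smooth_is_derive _ _ tk.1).
rewrite -mulN1r -RintegralZl//; last first.
  by apply: conv_integrable => //; exact: test_partial.
by congr (Rintegral _ _ _); apply/funext => y; rewrite mulN1r mulrN.
Qed.

End convolution.

(** * Density of continuous functions in L1 of a cube *)

Section dominated_real.
Context d (T : measurableType d) (R : realType) (mu : {measure set T -> \bar R}).

Lemma Rintegral_dominated_cvg (D : set T) (F : nat -> T -> R) (f g : T -> R) :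
  measurable D -> (forall m, measurable_fun D (F m)) -> measurable_fun D f ->
  (forall x, D x -> F m x @[m --> \oo] --> f x) ->
  mu.-integrable D (EFin \o g) -> (forall m x, D x -> `|F m x| <= g x) ->
  \int[mu]_(x in D) F m x @[m --> \oo] --> \int[mu]_(x in D) f x.
Proof.
move=> mD mF mf Ff ig Fg.
have [| | | | |intf _ H] := @dominated_convergence _ _ _ mu D mD (fun m => EFin \o F m)
  (EFin \o f) (EFin \o g).
- by move=> m; exact/measurable_EFinP.
- exact/measurable_EFinP.
- by apply: aeW => x Dx; apply: cvg_EFin; [exact: nearW|exact: Ff].
- exact: ig.
- by apply: aeW => x m Dx; rewrite /= lee_fin; exact: Fg.
by apply: fine_cvg; rewrite fineK//; exact: integrable_fin_num.
Qed.

End dominated_real.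

Section L1_approximation.
Context (R : realType) (n : nat).
Local Notation V := 'rV[R]_n.
Local Notation mu := (@rV_lebesgue R n).
Implicit Types (g h w : V -> R) (x y : V) (r e : R).

Definition L1_norm r g : R := \int[mu]_(x in cube r) `|g x|.

Lemma L1_norm_ge0 r g : 0 <= L1_norm r g.
Proof. exact: Rintegral_ge0. Qed.

Lemma L1_normE r g : locally_bounded g ->
  (L1_norm r g)%:E = (\int[mu]_(x in cube r) `|g x|%:E)%E.
Proof.
move=> lg; rewrite /L1_norm /Rintegral fineK//; apply: integrable_fin_num.
  exact: measurable_cube.
by apply: locally_bounded_integrable; exact: locally_bounded_norm.
Qed.

Lemma L1_norm_leD r g a b : locally_bounded g -> locally_bounded a ->
  locally_bounded b ->
  (forall x, cube r x -> `|g x| <= `|a x| + `|b x|) ->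
  L1_norm r g <= L1_norm r a + L1_norm r b.
Proof.
move=> lg la lb gab.
have ia := locally_bounded_integrable r (locally_bounded_norm la).
have ib := locally_bounded_integrable r (locally_bounded_norm lb).
rewrite /L1_norm -RintegralD//; last exact: measurable_cube.
apply: le_Rintegral => //; first exact: measurable_cube.
  exact: locally_bounded_integrable (locally_bounded_norm lg).
exact: (integrableD (measurable_cube _) ia ib).
Qed.

Lemma locally_bounded_cst (c : R) : locally_bounded (fun _ : V => c).
Proof. by apply: continuous_locally_bounded; exact: cst_continuous. Qed.

Lemma L1_norm_le_cst r g c : 0 <= r -> locally_bounded g ->
  (forall x, cube r x -> `|g x| <= c) -> L1_norm r g <= c * (2 * r) ^+ n.
Proof.
move=> r0 lg gc.
rewrite (_ : (2 * r) ^+ n = fine (mu (cube r))); last by rewrite rV_lebesgue_cube.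
rewrite -Rintegral_cst; last exact: measurable_cube.
apply: le_Rintegral => //; first exact: measurable_cube.
  exact: locally_bounded_integrable (locally_bounded_norm lg).
by apply: locally_bounded_integrable; exact: locally_bounded_cst.
Qed.

Lemma L1_norm_le_mono r s g : r <= s -> locally_bounded g -> L1_norm r g <= L1_norm s g.
Proof.
move=> rs lg; rewrite -lee_fin !L1_normE//.
apply: ge0_subset_integral => //; [exact: measurable_cube..| |exact: cube_le].
by apply/measurable_EFinP; exact: measurable_funTS (locally_bounded_norm lg).1.
Qed.

Lemma L1_normZ r g c : locally_bounded g ->
  L1_norm r (fun x => c * g x) = `|c| * L1_norm r g.
Proof.
move=> lg; rewrite /L1_norm -RintegralZl; [|exact: measurable_cube|]; last first.
  exact: locally_bounded_integrable (locally_bounded_norm lg).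
by congr (Rintegral _ _ _); apply/funext => x; rewrite normrM.
Qed.

Lemma L1_norm_cvg0 r (F : nat -> V -> R) C :
  (forall m, locally_bounded (F m)) ->
  (forall m x, cube r x -> `|F m x| <= C) ->
  (forall x, cube r x -> F m x @[m --> \oo] --> 0) ->
  L1_norm r (F m) @[m --> \oo] --> 0.
Proof.
move=> lF FC F0.
rewrite (_ : 0 = \int[mu]_(x in cube r) (fun=> 0 : R) x); last first.
  by rewrite Rintegral_cst ?mul0r//; exact: measurable_cube.
apply: (@Rintegral_dominated_cvg _ _ _ mu _ _ _ (fun=> C)).
- exact: measurable_cube.
- by move=> m; apply: measurable_funTS; exact: (locally_bounded_norm (lF m)).1.
- exact: measurable_cst.
- by move=> x xr; rewrite -(normr0 R); apply: cvg_norm; exact: F0.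
- by apply: locally_bounded_integrable; exact: locally_bounded_cst.
- by move=> m x xr; rewrite normr_id; exact: FC.
Qed.

Lemma locally_boundedD g h : locally_bounded g -> locally_bounded h ->
  locally_bounded (fun x => g x + h x).
Proof.
move=> lg [mh hC].
rewrite (_ : (fun x => _) = (fun x => g x - - h x)); last first.
  by apply/funext => x; rewrite opprK.
apply: locally_boundedB => //; split; first exact: measurable_funN.
by move=> s; have [C {}hC] := hC s; exists C => x; rewrite normrN; exact: hC.
Qed.

Lemma locally_bounded_indic (E : set V) : measurable E ->
  locally_bounded (\1_E : V -> R).
Proof.
move=> mE; split; first exact: measurable_indic.
by move=> s; exists 1 => x _; rewrite indicE; case: (_ \in _); rewrite ?normr1 ?normr0.
Qed.

(** Continuous functions are dense in L1 of a cube: the sets whose indicator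
    functions they approximate form a sigma-algebra containing the half-spaces.
    The values of [h] are kept in [0, 1] so that products of approximations
    approximate intersections. *)
Definition approximable r (E : set V) := measurable E /\
  forall eta, 0 < eta -> exists h, [/\ continuous h, (forall x, 0 <= h x <= 1) &
    L1_norm r (fun x => \1_E x - h x) <= eta].

Lemma indicC (E : set V) x : \1_(~` E) x = 1 - \1_E x :> R.
Proof.
rewrite !indicE in_setC; case: (x \in E) => /=; first by rewrite subrr.
by rewrite subr0.
Qed.

Lemma approximableC r E : approximable r E -> approximable r (~` E).
Proof.
move=> [mE hE]; split; first exact: measurableC.
move=> eta /hE[h [ch h01 hL]]; exists (fun x => 1 - h x); split.
- by move=> x; exact: (cvgB (cvg_cst (1 : R)) (ch x)).
- by move=> x; have /andP[] := h01 x; lra.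
- rewrite (_ : L1_norm _ _ = L1_norm r (fun x => \1_E x - h x))//.
  congr (Rintegral _ _ _); apply/funext => x; rewrite indicC distrC.
  by congr (`|_|); ring.
Qed.

Lemma approximableI r E F : approximable r E -> approximable r F ->
  approximable r (E `&` F).
Proof.
move=> [mE hE] [mF hF]; have mEF := measurableI _ _ mE mF; split => //.
move=> eta eta0; have eta2 : 0 < eta / 2 by rewrite divr_gt0.
have [h [ch h01 hL]] := hE _ eta2; have [k [ck k01 kL]] := hF _ eta2.
exists (fun x => h x * k x); split.
- by move=> x; exact: (cvgM (ch x) (ck x)).
- move=> x; have /andP[? ?] := h01 x; have /andP[? ?] := k01 x.
  by rewrite mulr_ge0//= mulr_ile1.
- have lh := continuous_locally_bounded ch; have lk := continuous_locally_bounded ck.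
  rewrite [leRHS](splitr eta); apply: le_trans (lerD hL kL).
  apply: L1_norm_leD.
  + by apply: locally_boundedB; [exact: locally_bounded_indic|exact: locally_boundedM].
  + by apply: locally_boundedB => //; exact: locally_bounded_indic.
  + by apply: locally_boundedB => //; exact: locally_bounded_indic.
  move=> x _; have /andP[h0 h1] := h01 x.
  rewrite (_ : \1_(E `&` F) x = \1_E x * \1_F x); last first.
    by rewrite indicI.
  rewrite (_ : _ * _ - _ = (\1_E x - h x) * \1_F x + h x * (\1_F x - k x)); last by ring.
  apply: (le_trans (ler_normD _ _)); rewrite !normrM; apply: lerD.
    by rewrite ler_piMr// indicE; case: (_ \in _); rewrite ?normr1 ?normr0.
  by rewrite ler_piMl// ger0_norm.
Qed.

Lemma approximable0 r : approximable r set0.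
Proof.
split=> // eta eta0; exists (fun=> 0); split; first exact: cst_continuous.
  by move=> x; rewrite lexx ler01.
rewrite /L1_norm (_ : (fun x => _) = fun=> 0); last first.
  by apply/funext => x; rewrite indic0 subrr normr0.
by rewrite Rintegral_cst ?mul0r ?ltW//; exact: measurable_cube.
Qed.

Lemma approximable_bigcup r (F : nat -> set V) :
  (forall m, approximable r (F m)) -> approximable r (\bigcup_m F m).
Proof.
move=> aF.
have aU m : approximable r (\big[setU/set0]_(i < m) F i).
  elim: m => [|m IH]; first by rewrite big_ord0; exact: approximable0.
  rewrite big_ord_recr /= -[X in approximable r X]setCK setCU.
  by apply: approximableC; apply: approximableI; apply: approximableC.
have mU : measurable (\bigcup_m F m) by apply: bigcupT_measurable => m; exact: (aF m).1.
split=> // eta eta0; have eta2 : 0 < eta / 2 by rewrite divr_gt0.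
pose U m := \big[setU/set0]_(i < m) F i.
have lI E : measurable E -> locally_bounded (\1_E : V -> R) by exact: locally_bounded_indic.
have : L1_norm r (fun x => \1_(\bigcup_m F m) x - \1_(U m) x) @[m --> \oo] --> (0 : R).
  apply: (@L1_norm_cvg0 _ _ 1).
  - by move=> m; apply: locally_boundedB; apply: lI => //; exact: (aU m).1.
  - move=> m x _; rewrite !indicE.
    by do 2 case: (_ \in _); rewrite ?subrr ?subr0 ?sub0r ?normrN ?normr1 ?normr0.
  - move=> x _; apply: (@cvg_near_cst _ _ _ _ _ _); rewrite !indicE.
    have [[k _ Fk]|nF] := pselect ((\bigcup_m F m) x).
      exists k.+1 => // m /= km; rewrite indicE !mem_set ?subrr//; last by exists k.
      rewrite /U -bigcup_mkord; by exists k.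
    apply: nearW => m; rewrite indicE !memNset ?subrr//.
    by rewrite /U -bigcup_mkord => -[k _ Fk]; apply: nF; exists k.
move=> /cvgr0Pnorm_le /(_ _ eta2)[N _ /(_ N (leqnn N))].
rewrite ger0_norm ?L1_norm_ge0// => UN.
have [h [ch h01 hL]] := (aU N).2 _ eta2; exists h; split=> //.
rewrite [leRHS](splitr eta); apply: le_trans (lerD UN hL).
have lh := continuous_locally_bounded ch; have mUN := (aU N).1.
apply: L1_norm_leD; [apply: locally_boundedB => //; exact: lI..|].
move=> x _; rewrite [X in `|X| <= _](_ : _ = (\1_(\bigcup_m F m) x - \1_(U N) x) +
  (\1_(U N) x - h x)); last by rewrite addrA subrK.
exact: ler_normD.
Qed.

Lemma approximable_sigma_algebra r : sigma_algebra setT (approximable r).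
Proof.
split; first exact: approximable0.
- by move=> E aE; rewrite setTD; exact: approximableC.
- exact: approximable_bigcup.
Qed.

Lemma approximable_halfspace r i (a : R) :
  approximable r [set x : V | a < x ord0 i].
Proof.
have mE : measurable [set x : V | a < x ord0 i].
  have := @coord_measurable R n i measurableT `]a, +oo[%classic (measurable_itv _).
  rewrite setTI; congr (measurable _); apply/seteqP; split=> x /=;
  by rewrite in_itv/= andbT.
split=> // eta eta0.
pose h m x := step (m%:R * x ord0 i + (- m%:R * a - 1)) : R.
have ch m : continuous (h m) by apply: smooth_continuous; exact: smooth_step.
have : L1_norm r (fun x => \1_[set x : V | a < x ord0 i] x - h m x)
    @[m --> \oo] --> (0 : R).
  apply: (@L1_norm_cvg0 _ _ 1).
  - by move=> m; apply: locally_boundedB;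
      [exact: locally_bounded_indic|exact: continuous_locally_bounded].
  - move=> m x _; have := step_ge0 (m%:R * x ord0 i + (- m%:R * a - 1)).
    have := step_le1 (m%:R * x ord0 i + (- m%:R * a - 1)); rewrite -/(h m x) => h1 h0.
    rewrite indicE; case: (_ \in _) => /=; last by rewrite sub0r normrN ger0_norm.
    by rewrite ger0_norm ?subr_ge0// gerBl.
  - move=> x _; apply: (@cvg_near_cst _ _ _ _ _ _); rewrite !indicE.
    have [ax|xa] := ltP a (x ord0 i).
      exists (Num.truncn (2 / (x ord0 i - a))).+1 => // m /= km.
      rewrite mem_set// /h step1 ?subrr//.
      suff : 2 <= m%:R * (x ord0 i - a) by lra.
      rewrite -ler_pdivrMr ?subr_gt0//; apply/ltW.
      by apply: (lt_le_trans (truncnS_gt _)); rewrite ler_nat.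
    apply: nearW => m; rewrite memNset/= ?ltNge ?xa//.
    rewrite /h step0 ?subrr//.
    have : 0 <= m%:R * (a - x ord0 i) by rewrite mulr_ge0// subr_ge0.
    by lra.
move=> /cvgr0Pnorm_le /(_ _ eta0)[N _ /(_ N (leqnn N))].
rewrite ger0_norm ?L1_norm_ge0// => hN; exists (h N); split=> // x.
by rewrite step_ge0 step_le1.
Qed.

Lemma measurable_approximable r (E : set V) : measurable E -> approximable r E.
Proof.
apply: smallest_sub E; first exact: approximable_sigma_algebra.
rewrite -bigcup_seq; apply: bigcup_sub => i _ _ [B mB <-].
rewrite setTI.
pose G := [set B : set R | approximable r ((fun x : V => x ord0 i) @^-1` B)].
have sG : sigma_algebra setT G.
  have [s0 sC sU] := approximable_sigma_algebra r; split.
  - by rewrite /G/= preimage_set0.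
  - by move=> A aA; rewrite /G/= setTD -preimage_setC -setTD; exact: sC.
  - by move=> A aA; rewrite /G/= preimage_bigcup; exact: sU.
suff : (@measurable _ (measurableTypeR R)) `<=` G by apply.
rewrite RGenOInfty.measurableE; apply: smallest_sub => // _ [a ->].
rewrite /G/= (_ : _ @^-1` _ = [set x : V | a < x ord0 i]).
  exact: approximable_halfspace.
by apply/seteqP; split=> x /=; rewrite in_itv/= andbT.
Qed.

End L1_approximation.

(** * Mollification converges in L1 of a cube *)

Section L1_mollification.
Context (R : realType) (n : nat).
Local Notation V := 'rV[R]_n.
Local Notation mu := (@rV_lebesgue R n).
Implicit Types (g h w : V -> R) (x y : V) (r e : R).

Definition L1_close r g (eta : R) := locally_bounded g /\
  exists2 h : V -> R, continuous h & L1_norm r (fun x => g x - h x) <= eta.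

Lemma L1_closeD r g1 g2 a b : L1_close r g1 a -> L1_close r g2 b ->
  L1_close r (fun x => g1 x + g2 x) (a + b).
Proof.
move=> [l1 [h1 c1 H1]] [l2 [h2 c2 H2]]; split; first exact: locally_boundedD.
have k1 := continuous_locally_bounded c1; have k2 := continuous_locally_bounded c2.
exists (fun x => h1 x + h2 x); first by move=> x; exact: (cvgD (c1 x) (c2 x)).
apply: le_trans (lerD H1 H2).
apply: L1_norm_leD; [|exact: locally_boundedB|exact: locally_boundedB|].
  by apply: locally_boundedB; exact: locally_boundedD.
by move=> x _; rewrite opprD addrACA; exact: ler_normD.
Qed.

Lemma L1_closeZ r g a c : L1_close r g a -> L1_close r (fun x => c * g x) (`|c| * a).
Proof.
move=> [lg [h ch H]]; split.
  by apply: locally_boundedM => //; exact: locally_bounded_cst.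
exists (fun x => c * h x); first by move=> x; exact: (cvgM (cvg_cst c) (ch x)).
rewrite (_ : (fun x => _) = fun x => c * (g x - h x)); last first.
  by apply/funext => x; rewrite mulrBr.
rewrite L1_normZ ?ler_wpM2l//; apply: locally_boundedB => //.
exact: continuous_locally_bounded.
Qed.

Lemma L1_close0 r c : 0 <= r -> L1_close r (fun=> c) 0.
Proof.
move=> r0; split; first exact: locally_bounded_cst.
exists (fun=> c); first exact: cst_continuous.
rewrite -[leRHS](mul0r ((2 * r) ^+ n)); apply: L1_norm_le_cst => //.
  by apply: locally_boundedB; exact: locally_bounded_cst.
by move=> x _; rewrite subrr normr0.
Qed.

Lemma L1_close_sum r N (F : nat -> V -> R) a : 0 <= r ->
  (forall j, L1_close r (F j) a) ->
  L1_close r (fun x => \sum_(j < N) F j x) (N%:R * a).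
Proof.
move=> r0 Fa; elim: N => [|N IH].
  under eq_fun do rewrite big_ord0; rewrite mul0r; exact: L1_close0.
under eq_fun do rewrite big_ord_recr /=.
by rewrite -natr1 mulrDl mul1r; exact: L1_closeD.
Qed.

(** The sum counts the integers between 1 and [t]. Scaled by [N^-1], it presents a
    function with values in [0, 1] as a combination of indicators up to [N^-1]. *)
Lemma staircase N (t : R) : 0 <= t -> t <= N%:R ->
  t - 1 <= \sum_(j < N) (j.+1%:R <= t)%R%:R <= t.
Proof.
move=> t0; elim: N => [|N IH] tN; first by rewrite big_ord0; apply/andP; split; lra.
rewrite big_ord_recr /=; have [tN'|Nt] := leP t N%:R.
  have /IH := tN'; have [h|h] := leP N.+1%:R t; last by rewrite addr0.
  by move: h; rewrite -natr1 => h _; exfalso; lra.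
rewrite (eq_bigr (fun=> 1)); last first.
  move=> j _; rewrite (_ : (j.+1%:R <= t) = true)//.
  by apply/ltW; apply: le_lt_trans Nt; rewrite ler_nat.
rewrite sumr_const card_ord; have [h|h] := leP N.+1%:R t.
  by move: h tN; rewrite -!natr1 => h tN; apply/andP; split; lra.
by move: h tN; rewrite -!natr1 => h tN; rewrite addr0; apply/andP; split; lra.
Qed.

Lemma L1_close_unit r g eta : 0 <= r -> measurable_fun setT g ->
  (forall x, 0 <= g x <= 1) -> 0 < eta -> L1_close r g eta.
Proof.
move=> r0 mg g01 eta0.
have lg : locally_bounded g.
  split=> // s; exists 1 => x _; have /andP[h0 h1] := g01 x; by rewrite ger0_norm.
split=> //.
pose A : R := (2 * r) ^+ n; have A0 : 0 <= A by rewrite exprn_ge0// mulr_ge0.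
have eta2 : 0 < eta / 2 by rewrite divr_gt0.
pose N := (Num.truncn (A / (eta / 2))).+1.
have N0 : 0 < N%:R :> R by rewrite ltr0n.
have NA : N%:R^-1 * A <= eta / 2.
  by rewrite ler_pdivrMl// -ler_pdivrMr// ltW// truncnS_gt.
pose F j x : R := \1_[set x | j.+1%:R <= N%:R * g x] x.
have FE x j : F j x = (j.+1%:R <= N%:R * g x)%R%:R.
  rewrite /F indicE; congr (nat_of_bool _)%:R; apply/idP/idP; by rewrite inE.
have mF j : measurable [set x | j.+1%:R <= N%:R * g x].
  have mNg : measurable_fun setT (fun x => N%:R * g x) by exact: measurable_funM.
  have := mNg measurableT `[j.+1%:R, +oo[%classic (measurable_itv _).
  by rewrite setTI; congr (measurable _); apply/seteqP; split=> x /=;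
    rewrite in_itv/= andbT.
have Fc j : L1_close r (F j) (eta / 2).
  split; first exact: locally_bounded_indic.
  have [_ /(_ _ eta2)[h [ch _ hL]]] := measurable_approximable r (mF j).
  by exists h.
have [ls [h ch hL]] := L1_closeZ N%:R^-1 (L1_close_sum N r0 Fc).
exists h => //.
rewrite [leRHS](splitr eta).
have lh := continuous_locally_bounded ch.
pose s x := N%:R^-1 * \sum_(j < N) F j x.
apply: (@le_trans _ _ (L1_norm r (fun x => g x - s x) + L1_norm r (fun x => s x - h x))).
  apply: L1_norm_leD; [exact: locally_boundedB..|].
  by move=> x _; rewrite -[X in `|X| <= _](subrKA (s x)); exact: ler_normD.
apply: lerD; last first.
  by apply: (le_trans hL); rewrite ger0_norm ?invr_ge0// mulrA mulVf ?mul1r// gt_eqF.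
apply: le_trans NA; apply: L1_norm_le_cst => //; first exact: locally_boundedB.
move=> x _; have /andP[g0 g1] := g01 x.
have := @staircase N (N%:R * g x); rewrite mulr_ge0// ?ler_piMr// => /(_ isT isT).
rewrite /s; under eq_bigr do rewrite -FE.
move: (\sum_(j < N) _) => S /andP[S1 S2].
rewrite (_ : g x - N%:R^-1 * S = N%:R^-1 * (N%:R * g x - S)); last first.
  by rewrite mulrBr mulrA mulVf ?mul1r// gt_eqF.
rewrite normrM ger0_norm ?invr_ge0// ler_piMr ?invr_ge0//.
by rewrite ger0_norm; lra.
Qed.

Lemma L1_close_bounded r g C eta : 0 <= r -> measurable_fun setT g ->
  (forall x, `|g x| <= C) -> 0 < eta -> L1_close r g eta.
Proof.
move=> r0 mg gC eta0; pose D := `|C| + 1.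
have D0 : 0 < D by rewrite ltr_wpDl.
have gD x : - D <= g x <= D.
  by rewrite -ler_norml (le_trans (gC x))// (le_trans (ler_norm _))// lerDl.
pose u x := (2 * D)^-1 * (g x + D).
have D2 : 0 < 2 * D by rewrite mulr_gt0.
have uc : L1_close r u (eta / (2 * D)).
  apply: L1_close_unit => //; last by rewrite divr_gt0.
    apply: measurable_funM; first exact: measurable_cst.
    by apply: measurable_funD => //; exact: measurable_cst.
  move=> x; have /andP[g1 g2] := gD x; apply/andP; split.
    by rewrite mulr_ge0 ?invr_ge0 ?(ltW D2)// -lerBlDr sub0r.
  by rewrite /u ler_pdivrMl// mulr1 mulr_natl mulr2n lerD2r.
have := L1_closeD (L1_closeZ (2 * D) uc) (L1_close0 (- D) r0).
rewrite addr0 ger0_norm ?ltW// mulrCA divff ?mulr1 ?gt_eqF//.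
rewrite (_ : (fun x => _) = g)//; apply/funext => x.
by rewrite /u mulrA divff ?mul1r ?addrK// gt_eqF.
Qed.

Lemma conv_bound u k x c : locally_bounded u -> test_function k ->
  (forall y, 0 <= k y) -> \int[mu]_y k (x - y) = 1 ->
  (forall y, k (x - y) != 0 -> `|u y| <= c) -> `|conv u k x| <= c.
Proof.
move=> lu tk k0 k1 uc.
have ik : mu.-integrable setT (EFin \o (fun y => k (x - y))).
  by apply: bounded_support_integrable; apply: test_bounded_support; exact: test_reflect.
apply: (le_trans (le_normr_Rintegral measurableT (conv_integrable x lu tk))).
rewrite -[leRHS]mulr1 -k1 -RintegralZl//; apply: le_Rintegral => //.
- by apply: integrable_norm; exact: conv_integrable.
- exact: (integrableZl _ _ ik).
- move=> y _; rewrite normrM (ger0_norm (k0 _)).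
  have [->|ky] := eqVneq (k (x - y)) 0; first by rewrite !mulr0.
  by rewrite ler_wpM2r// uc.
Qed.

Lemma Rintegral_mollifier e x : 0 < e -> \int[mu]_y mollifier e (x - y) = 1.
Proof. by move=> e0; rewrite /Rintegral integral_mollifier. Qed.

Lemma conv_sub_cst u k x c : locally_bounded u -> test_function k ->
  \int[mu]_y k (x - y) = 1 -> conv (fun y => u y - c) k x = conv u k x - c.
Proof.
move=> lu tk k1; have lc := locally_bounded_cst n c.
rewrite -[X in _ = _ - X]mulr1 -k1 -RintegralZl//; last first.
  by apply: bounded_support_integrable; apply: test_bounded_support; exact: test_reflect.
rewrite /conv -RintegralB//; [|exact: conv_integrable|].
  by congr (Rintegral _ _ _); apply/funext => y; rewrite mulrBl.
exact: (conv_integrable x lc tk).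
Qed.

Lemma mollify_dist u e x c : 0 < e -> locally_bounded u ->
  (forall y, cube e (x - y) -> `|u y - u x| <= c) ->
  `|conv u (mollifier e) x - u x| <= c.
Proof.
move=> e0 lu uc; have tk := test_mollifier n e0.
rewrite -conv_sub_cst//; last exact: Rintegral_mollifier.
apply: conv_bound => //.
- by apply: locally_boundedB => //; exact: locally_bounded_cst.
- by move=> y; exact: mollifier_ge0.
- exact: Rintegral_mollifier.
- move=> y ky; apply: uc; apply: contrapT => /(mollifier_support e0) k0.
  by rewrite k0 eqxx in ky.
Qed.

Lemma mollify_ge u e x m : 0 < e -> locally_bounded u -> (forall y, m <= u y) ->
  m <= conv u (mollifier e) x.
Proof.
move=> e0 lu um; rewrite -subr_ge0 -conv_sub_cst//.
- by apply: Rintegral_ge0 => y _; rewrite mulr_ge0 ?subr_ge0 ?mollifier_ge0.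
- exact: test_mollifier.
- exact: Rintegral_mollifier.
Qed.

Definition scale (m : nat) : R := m.+1%:R^-1.

Lemma scale_gt0 m : 0 < scale m. Proof. by rewrite invr_gt0. Qed.

Lemma scale_le1 m : scale m <= 1. Proof. by rewrite invf_le1// ler1n. Qed.

Lemma mollify_cvg u x : continuous u ->
  conv u (mollifier (scale m)) x @[m --> \oo] --> u x.
Proof.
move=> cu; have lu := continuous_locally_bounded cu.
apply/cvgrPdist_le => e e0.
have /(cvgrPdist_le _ (u x)).1/(_ e e0) : u y @[y --> x] --> u x by exact: cu.
move=> /nbhs_ballP[d /= d0 ud].
exists (Num.truncn d^-1) => // m /= dm; rewrite distrC.
apply: mollify_dist => //; first exact: scale_gt0.
move=> y yx; rewrite distrC; apply: ud; apply/ball_rV => // i.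
have := yx i; rewrite !mxE => /le_lt_trans; apply.
by rewrite /scale invf_plt ?posrE// (lt_le_trans (truncnS_gt _))// ler_nat.
Qed.

Lemma measurable_subV : measurable_fun setT (fun z : V * V => z.1 - z.2).
Proof.
apply/measurable_fun_rVP => i.
rewrite (_ : _ \o _ = (fun z : V * V => z.1 ord0 i - z.2 ord0 i)); last first.
  by apply/funext => z; rewrite /= /rV_coord !mxE.
apply: measurable_funB.
  by apply: (measurableT_comp (@coord_measurable R n i)); exact: measurable_fst.
by apply: (measurableT_comp (@coord_measurable R n i)); exact: measurable_snd.
Qed.

(** Young's convolution inequality: by Tonelli, since the mollifier has mass 1 in
    each of its two variables. *)
Lemma L1_norm_mollify r e w : 0 < e -> locally_bounded w ->
  L1_norm r (conv w (mollifier e)) <= L1_norm (r + e) w.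
Proof.
move=> e0 lw; have tk := test_mollifier n e0.
have lc : locally_bounded (conv w (mollifier e)).
  by apply: continuous_locally_bounded; exact: conv_continuous.
have mk : measurable_fun setT (mollifier e : V -> R).
  by apply: continuous_measurable_rV; apply: smooth_continuous; exact: smooth_mollifier.
have mr := @measurable_cube R n r; have mre := @measurable_cube R n (r + e).
pose H (z : V * V) : \bar R :=
  (\1_(cube r) z.1 * (`|w z.2| * \1_(cube (r + e)) z.2) * mollifier e (z.1 - z.2))%:E.
have H0 z : (0 <= H z)%E by rewrite lee_fin !mulr_ge0// ?mollifier_ge0// indicE.
have mH : measurable_fun setT H.
  apply/measurable_EFinP; apply: measurable_funM.
    apply: measurable_funM.
      by apply: measurableT_comp measurable_fst; exact: measurable_indic.
    apply: (measurableT_comp (f := fun y => `|w y| * \1_(cube (r + e)) y)) measurable_snd.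
    by apply: measurable_funM; [exact: (locally_bounded_norm lw).1|exact: measurable_indic].
  by apply: (measurableT_comp mk); exact: measurable_subV.
have mabs v s : locally_bounded v ->
    measurable_fun setT ((fun x : V => (`|v x|)%:E) \_ (cube s)).
  move=> lv; apply: (measurable_restrictT _ (measurable_cube s)).1.
  by apply/measurable_EFinP; apply: measurable_funTS; exact: (locally_bounded_norm lv).1.
rewrite -lee_fin !L1_normE//.
apply: (@le_trans _ _ (\int[mu]_x \int[mu]_y H (x, y))%E).
  rewrite integral_mkcond; apply: ge0_le_integral => //.
  - by move=> x _; rewrite patchE; case: ifPn.
  - exact: mabs.
  - exact: (measurable_fun_fubini_tonelli_F (m2 := mu) _ mH).
  move=> x _; rewrite patchE; case: ifPn => [|_]; last exact: integral_ge0.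
  rewrite inE => xr.
  have iw := conv_integrable x lw tk.
  have /integrableP[mw _] := iw.
  rewrite /conv EFin_normr_Rintegral//.
  apply: (le_trans (le_abse_integral _ _ mw)) => //.
  rewrite (eq_integral (fun y => H (x, y)))// => y _.
  rewrite /H/= indicE mem_set// mul1r normrM (ger0_norm (mollifier_ge0 _ e0)).
  have [yr|yr] := pselect (cube (r + e) y); first by rewrite indicE mem_set// mulr1.
  rewrite (conv_support (r := e) _ xr yr) ?mulr0// => z; exact: mollifier_support.
rewrite (fubini_tonelli _ mH)// [leRHS]integral_mkcond.
apply: ge0_le_integral => //.
- by move=> y _; exact: integral_ge0.
- exact: (measurable_fun_fubini_tonelli_G (m1 := mu) _ mH).
- exact: mabs.
move=> y _; rewrite patchE.
have [yr|yr] := pselect (cube (r + e) y); last first.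
  have y0 : \1_(cube (r + e)) y = 0 :> R by rewrite indicE memNset.
  by rewrite memNset// integral0_eq// => x _; rewrite /H/= y0 !mulr0 mul0r.
have y1 : \1_(cube (r + e)) y = 1 :> R by rewrite indicE mem_set.
rewrite mem_set//.
apply: (@le_trans _ _ (\int[mu]_x (`|w y|%:E * (mollifier e (y - x))%:E))%E).
  apply: ge0_le_integral => //.
  - by apply: (measurableT_comp mH); exact: measurable_pair2.
  - apply: measurable_funeM; apply/measurable_EFinP.
    by have [] := test_bounded_support (test_reflect y tk).
  move=> x _; rewrite /H/= -EFinM lee_fin (mollifierC _ x y) ler_wpM2r ?mollifier_ge0//.
  rewrite y1 mulr1 ler_piMl//.
rewrite ge0_integralZl//.
- by rewrite integral_mollifier// mule1.
- apply/measurable_EFinP; by have [] := test_bounded_support (test_reflect y tk).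
- by move=> x _; rewrite lee_fin mollifier_ge0.
Qed.

(** Immediate for continuous functions; a general one is close to a continuous one
    in L1 of a slightly larger cube, and mollification does not expand L1 norms. *)
Theorem mollify_L1_cvg r g (C : R) : 0 <= r -> measurable_fun setT g ->
  (forall x, `|g x| <= C) ->
  L1_norm r (fun x => conv g (mollifier (scale m)) x - g x) @[m --> \oo] --> 0.
Proof.
move=> r0 mg gC; apply/cvgr0Pnorm_le => e e0.
have e3 : 0 < e / 3 by rewrite divr_gt0.
have r1 : 0 <= r + 1 by rewrite addr_ge0.
have [lg [h ch hL]] := L1_close_bounded r1 mg gC e3.
have lh := continuous_locally_bounded ch.
have tk m := test_mollifier n (scale_gt0 m).
have lconv (u : V -> R) m : locally_bounded u -> locally_bounded (conv u (mollifier (scale m))).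
  by move=> lu; apply: continuous_locally_bounded; exact: (conv_continuous lu (tk m)).
have lgh := locally_boundedB lg lh.
have : L1_norm r (fun x => conv h (mollifier (scale m)) x - h x) @[m --> \oo] --> (0 : R).
  have [D hD] := lh.2 (r + 1).
  apply: (@L1_norm_cvg0 _ _ _ _ (D + D)).
  - by move=> m; apply: locally_boundedB => //; exact: lconv.
  - move=> m x xr; apply: mollify_dist => //; first exact: scale_gt0.
    move=> y xy; apply: (le_trans (ler_normB _ _)); apply: lerD; apply: hD.
      rewrite -(subKr x y); apply: cubeD => //; apply: cubeN.
      exact: cube_le (scale_le1 m) _ xy.
    by apply: cube_le xr; rewrite lerDl.
  - move=> x _; apply/cvgr0Pnorm_le => d d0.
    have /cvgrPdist_le/(_ d d0) := @mollify_cvg h x ch.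
    by apply: filterS => m; rewrite distrC.
move=> /cvgr0Pnorm_le/(_ _ e3); apply: filterS => m.
rewrite !ger0_norm ?L1_norm_ge0// => hm.
rewrite (_ : e = e / 3 + (e / 3 + e / 3)); last by field.
pose a x := conv (fun x => g x - h x) (mollifier (scale m)) x.
have la : locally_bounded a by exact: lconv.
have ae : L1_norm r a <= e / 3.
  apply: le_trans hL; apply: (le_trans (L1_norm_mollify r (scale_gt0 m) lgh)).
  by apply: L1_norm_le_mono => //; rewrite lerD2l scale_le1.
have he : L1_norm r (fun x => g x - h x) <= e / 3.
  by apply: le_trans hL; apply: L1_norm_le_mono => //; rewrite lerDl.
have lhh : locally_bounded (fun x => conv h (mollifier (scale m)) x - h x).
  by apply: locally_boundedB => //; exact: lconv.
apply: le_trans (lerD ae (lerD hm he)).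
pose b x := (conv h (mollifier (scale m)) x - h x) - (g x - h x).
have lb : locally_bounded b by exact: locally_boundedB.
apply: (@le_trans _ _ (L1_norm r a + L1_norm r b)).
  apply: L1_norm_leD => //; first by apply: locally_boundedB => //; exact: lconv.
  move=> x _; rewrite (_ : conv g _ x - g x = a x + b x); first exact: ler_normD.
  rewrite /a /b (_ : conv (fun x => g x - h x) _ x =
    conv g (mollifier (scale m)) x - conv h (mollifier (scale m)) x).
    by ring.
  rewrite /conv -RintegralB//; last 2 first.
  - exact: (conv_integrable x lg (tk m)).
  - exact: (conv_integrable x lh (tk m)).
  by congr (Rintegral _ _ _); apply/funext => y; rewrite mulrBl.
rewrite lerD2l; apply: L1_norm_leD => //.
by move=> x _; exact: ler_normB.
Qed.

End L1_mollification.

(** * The flux, Young's inequality and cutoffs *)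

Section flux.
Context (R : realType) (n : nat).
Local Notation V := 'rV[R]_n.
Implicit Types (z a b : V) (p : R).

Lemma dotrV_ge0 z : 0 <= dotrV z z.
Proof. by apply: sumr_ge0 => i _; rewrite -expr2 sqr_ge0. Qed.

Lemma enorm_ge0 z : 0 <= enorm z.
Proof. exact: sqrtr_ge0. Qed.

Lemma coord_le_enorm z i : `|z ord0 i| <= enorm z.
Proof.
rewrite -sqrtr_sqr /enorm ler_wsqrtr// /dotrV (bigD1 i)//= -expr2 lerDl.
by apply: sumr_ge0 => j _; rewrite -expr2 sqr_ge0.
Qed.

Lemma p_flux_coord_le p z i : `|p_flux p z ord0 i| <= enorm z `^ (p - 1).
Proof.
rewrite /p_flux mxE normrM ger0_norm ?powR_ge0//.
have [z0|zn0] := eqVneq (enorm z) 0.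
  have := coord_le_enorm z i; rewrite z0 normr_le0 => /eqP ->.
  by rewrite normr0 mulr0 powR_ge0.
apply: (le_trans (ler_wpM2l (powR_ge0 _ _) (coord_le_enorm z i))).
rewrite -[X in _ * X]powRr1 ?enorm_ge0// -powRD; last by rewrite zn0 implybT.
by rewrite (_ : p - 2 + 1 = p - 1)//; ring.
Qed.

Lemma dotrV_p_flux p z : 0 < p -> dotrV (p_flux p z) z = enorm z `^ p.
Proof.
move=> p0; rewrite /dotrV /p_flux.
under eq_bigr do rewrite mxE -mulrA.
rewrite -mulr_sumr -/(dotrV z z) -(sqr_sqrtr (dotrV_ge0 z)) -/(enorm z).
have [->|zn0] := eqVneq (enorm z) 0.
  by rewrite expr0n /= mulr0 powR0// gt_eqF.
rewrite -powR_mulrn ?enorm_ge0// -powRD; last by rewrite zn0 implybT.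
by rewrite subrK.
Qed.

(** Young's inequality with a free parameter and without constants: one of the
    two terms on the right dominates according to whether [b <= D * a]. *)
Lemma young (p a b D : R) : 1 < p -> 0 < D -> 0 <= a -> 0 <= b ->
  a `^ (p - 1) * b <= D * a `^ p + D `^ (1 - p) * b `^ p.
Proof.
move=> p1 D0 a0 b0; have pn0 : p - 1 != 0 by rewrite gt_eqF// subr_gt0.
have p0 : p != 0 by rewrite gt_eqF// (lt_trans ltr01).
have S (t : R) : 0 <= t -> t `^ (p - 1) * t = t `^ p.
  move=> t0; rewrite -[X in _ * X]powRr1// -powRD; first by rewrite subrK.
  by rewrite subrK (negbTE p0).
have [h|h] := leP b (D * a).
  apply: (@le_trans _ _ (D * a `^ p)); last by rewrite lerDl mulr_ge0 ?powR_ge0.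
  by rewrite -S// mulrCA ler_wpM2l ?powR_ge0.
apply: (@le_trans _ _ (D `^ (1 - p) * b `^ p)); last first.
  by rewrite lerDr mulr_ge0 ?powR_ge0 ?ltW.
rewrite -(S b)// mulrA ler_wpM2r// -(opprB p 1) powRN.
rewrite ler_pdivlMl ?powR_gt0// -powRM ?(ltW D0)//.
by apply: ge0_ler_powR;
  rewrite ?nnegrE ?mulr_ge0 ?subr_ge0 ?(ltW p1) ?(ltW D0) ?(ltW h).
Qed.

End flux.

Section cutoff.
Context (R : realType) (n : nat).
Local Notation V := 'rV[R]_n.
Local Notation "''e_' i" := (delta_mx ord0 i : V) (at level 8, i at level 2).
Implicit Types (r t : R) (x : V).

Lemma hat_bounded : exists2 H : R, 0 <= H & forall t, hat t <= H.
Proof.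
have [||c _ cmax] := @EVT_max R hat (-1) 1; first by lra.
  exact/continuous_subspaceT/hat_continuous.
exists (hat c); first exact: hat_ge0.
move=> t; have [t1|t1] := leP 1 `|t|; first by rewrite hat_eq0 ?hat_ge0.
by apply: cmax; rewrite in_itv/= -ler_norml ltW.
Qed.

Let phi r t := step (- (2 / r) * t + 3) * step (2 / r * t + 3).

Let dphi r t := 2 / r * (step (- (2 / r) * t + 3) * hat (2 / r * t + 3) -
                         hat (- (2 / r) * t + 3) * step (2 / r * t + 3)).

(** A product of steps: 1 on the cube of radius [r], 0 off twice that cube. *)
Definition cutoff r x : R := \prod_(i < n) phi r (x ord0 i).

Lemma cutoff_ge0 r x : 0 <= cutoff r x.
Proof. by apply: prodr_ge0 => i _; rewrite mulr_ge0 ?step_ge0. Qed.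

Let phi_le1 r t : 0 <= phi r t <= 1.
Proof. by rewrite mulr_ge0 ?step_ge0//= mulr_ile1 ?step_ge0 ?step_le1. Qed.

Let arg_ge1 r t : 0 < r -> `|t| <= r ->
  1 <= - (2 / r) * t + 3 /\ 1 <= 2 / r * t + 3.
Proof.
move=> r0; rewrite ler_norml => /andP[t1 t2].
have h1 : t / r <= 1 by rewrite ler_pdivrMr// mul1r.
have h2 : - 1 <= t / r by rewrite ler_pdivlMr// mulN1r.
rewrite (_ : - (2 / r) * t = - 2 * (t / r)); last by rewrite mulNr mulNr mulrAC mulrA.
rewrite (_ : 2 / r * t = 2 * (t / r)); last by rewrite mulrAC mulrA.
by split; lra.
Qed.

Lemma cutoff1 r x : 0 < r -> cube r x -> cutoff r x = 1.
Proof.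
move=> r0 xr; rewrite /cutoff big1// => i _.
by have [h1 h2] := arg_ge1 r0 (xr i); rewrite /phi !step1// mulr1.
Qed.

Lemma cutoff0 r x : 0 < r -> ~ cube (2 * r) x -> cutoff r x = 0.
Proof.
move=> r0 /existsNP[i /negP]; rewrite -ltNge => xi.
rewrite /cutoff (bigD1 i)//= (_ : phi _ _ = 0) ?mul0r//.
have : 2 < `|x ord0 i / r|.
  by rewrite normrM normfV (gtr0_norm r0) ltr_pdivlMr.
rewrite /phi (_ : - (2 / r) * x ord0 i = - 2 * (x ord0 i / r)); last first.
  by rewrite mulNr mulNr mulrAC mulrA.
rewrite (_ : 2 / r * x ord0 i = 2 * (x ord0 i / r)); last by rewrite mulrAC mulrA.
rewrite ltr_normr => /orP[] h.
  by rewrite step0 ?mul0r//; lra.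
by rewrite [X in _ * X]step0 ?mulr0//; lra.
Qed.

Lemma smooth_cutoff r : smooth (cutoff r).
Proof. by apply: smooth_prod => i; apply: smoothM; exact: smooth_step. Qed.

Lemma test_cutoff r : 0 < r -> test_function (cutoff r).
Proof.
move=> r0; apply: (@test_functionI _ _ _ (2 * r)); first exact: smooth_cutoff.
by move=> x; exact: cutoff0.
Qed.

Let is_derive_phi r t : is_derive t 1 (phi r) (dphi r t).
Proof.
have L (a : R) : is_derive t 1 (fun t => a * t + 3) a.
  have D := is_deriveD (is_deriveM (is_derive_cst a t (1 : R)) (is_derive_id t (1 : R)))
    (is_derive_cst (3 : R) t (1 : R)).
  by apply: (is_derive_eq D); rewrite /GRing.scale /=; ring.
have E1 := @is_derive1_comp R (@step R) _ t _ _ (is_derive_step _) (L (- (2 / r))).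
have E2 := @is_derive1_comp R (@step R) _ t _ _ (is_derive_step _) (L (2 / r)).
apply: (is_derive_eq (is_deriveM E1 E2)); rewrite /GRing.scale /= /dphi; ring.
Qed.

Lemma partial_cutoff r i x : partial i (cutoff r) x =
  dphi r (x ord0 i) * \prod_(j < n | j != i) phi r (x ord0 j).
Proof.
set P := \prod_(j < n | _) _.
suff [] : is_derive x 'e_i (cutoff r) (dphi r (x ord0 i) * P) by [].
apply/is_derive_line.
rewrite (_ : (fun h => _) = (fun h : R => phi r (h + x ord0 i) * P)); last first.
  apply/funext => h; rewrite /cutoff (bigD1 i)//= !mxE !eqxx/= mulr1; congr (_ * _).
  by apply: eq_bigr => j ji; rewrite !mxE (negbTE ji) andbF mulr0 add0r.
have L : is_derive (0 : R) 1 (fun h : R => h + x ord0 i) 1.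
  apply: (is_derive_eq (is_deriveD (is_derive_id (0 : R) (1 : R))
    (is_derive_cst (x ord0 i : R) (0 : R) (1 : R)))); exact: addr0.
have F : is_derive (0 + x ord0 i) 1 (phi r) (dphi r (x ord0 i)).
  by rewrite add0r; exact: is_derive_phi.
have E := is_deriveM (@is_derive1_comp R (phi r) (fun h : R => h + x ord0 i) 0 _ _ F L)
  (is_derive_cst P (0 : R) (1 : R)).
by apply: (is_derive_eq E); rewrite /GRing.scale /=; ring.
Qed.

Lemma partial_cutoff_eq0 r i x : 0 < r -> cube r x -> partial i (cutoff r) x = 0.
Proof.
move=> r0 xr; rewrite partial_cutoff.
have [h1 h2] := arg_ge1 r0 (xr i).
rewrite /dphi !hat_eq0 ?mulr0 ?mul0r ?subrr ?mulr0 ?mul0r// ger0_norm//;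
by rewrite (le_trans ler01).
Qed.

Lemma partial_cutoff_le : exists2 K : R, 0 <= K &
  forall r i x, 0 < r -> `|partial i (cutoff r) x| <= K / r.
Proof.
have [H H0 hH] := hat_bounded; exists (4 * H); first by rewrite mulr_ge0.
move=> r i x r0; rewrite partial_cutoff normrM.
have P1 : `|\prod_(j < n | j != i) phi r (x ord0 j)| <= 1.
  rewrite ger0_norm; last by apply: prodr_ge0 => j _; have /andP[] := phi_le1 r (x ord0 j).
  by apply: prodr_ile1 => j _; exact: phi_le1.
apply: (le_trans (ler_piMr _ P1)) => //.
have term a b : `|step a * hat b| <= H.
  rewrite normrM !ger0_norm ?step_ge0 ?hat_ge0//.
  by apply: (le_trans (ler_piMl (hat_ge0 b) (step_le1 a))); exact: hH.
rewrite /dphi normrM ger0_norm ?divr_ge0 ?(ltW r0)//.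
rewrite (_ : 4 * H / r = 2 / r * (H + H)); last by ring.
rewrite ler_wpM2l ?divr_ge0 ?(ltW r0)//.
apply: (le_trans (ler_normB _ _)); apply: lerD; first exact: term.
by rewrite mulrC; exact: term.
Qed.

End cutoff.

(** * A vanishing criterion for sequences *)

Section hole_filling.
Context {R : realType}.

(** With a small [D], iterating the last inequality beats the growth bound, so [a]
    is bounded. Its increments then have a bounded sum, and averaging the
    inequality over many indices leaves [D^(1-p) * C], small for large [D]. *)
Lemma hole_filling (a : nat -> R) (p q M C : R) : 1 < p -> 1 <= q -> 0 <= C ->
  (forall k, 0 <= a k) -> (forall k, a k <= a k.+1) ->
  (forall k, a k <= M * q ^+ k) ->
  (forall D k, 0 < D -> a k <= D * (a k.+1 - a k) + D `^ (1 - p) * C) ->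
  forall k, a k = 0.
Proof.
move=> p1 q1 C0 a0 aS aM aD.
have q0 : 0 < q by rewrite (lt_le_trans ltr01).
(* small enough to beat the growth rate q by a factor 2 *)
pose D0 := (2 * q)^-1.
have D00 : 0 < D0 by rewrite invr_gt0 mulr_gt0.
have D02 : D0 <= 2^-1 by rewrite lef_pV2 ?posrE ?mulr_gt0// ler_peMr.
pose L := D0 `^ (1 - p) * C.
have L0 : 0 <= L by rewrite mulr_ge0 ?powR_ge0.
have step k : a k <= D0 * a k.+1 + L.
  apply: (le_trans (aD _ k D00)); rewrite lerD2r ler_pM2l// gerBl; exact: a0.
have iter j k : a k <= D0 ^+ j * a (k + j)%N + 2 * L.
  elim: j k => [|j IH] k; first by rewrite expr0 mul1r addn0 lerDl mulr_ge0.
  apply: (le_trans (step k)); rewrite exprS -mulrA addnS -addSn.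
  apply: (@le_trans _ _ (D0 * (D0 ^+ j * a (k.+1 + j)%N + 2 * L) + L)).
    by rewrite lerD2r ler_pM2l.
  rewrite mulrDr -addrA lerD2l (_ : 2 * L = L + L); last by ring.
  rewrite lerD2r -[leRHS]mul1r -mulr2n -mulr_natl mulrA ler_wpM2r//.
  by rewrite -ler_pdivlMr// mul1r.
have M0 : 0 <= M by apply: (le_trans (a0 0)); have := aM 0; rewrite expr0 mulr1.
have bdd k : a k <= 2 * L.
  apply/ler_addgt0Pr => e e0.
  pose B := M * q ^+ k; have B0 : 0 <= B by rewrite mulr_ge0// exprn_ge0// ltW.
  pose j := (Num.truncn (B / e)).+1.
  apply: (le_trans (iter j k)); rewrite addrC lerD2l.
  apply: (@le_trans _ _ (D0 ^+ j * (M * q ^+ (k + j)))).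
    by rewrite ler_wpM2l ?exprn_ge0 ?(ltW D00).
  rewrite (_ : D0 ^+ j * (M * q ^+ (k + j)) = B / 2 ^+ j); last first.
    rewrite /D0 /B exprD exprVn exprMn; field.
    by rewrite !expf_neq0// gt_eqF.
  rewrite ler_pdivrMr ?exprn_gt0// -ler_pdivrMl// mulrC.
  apply: (@le_trans _ _ j%:R); first by rewrite ltW// truncnS_gt.
  by rewrite -natrX ler_nat ltnW// ltn_expl.
have sum D k N : 0 < D ->
    N%:R * a k <= D * (a (k + N)%N - a k) + N%:R * (D `^ (1 - p) * C).
  move=> D_gt0; elim: N => [|N IH]; first by rewrite addn0 subrr mulr0 !mul0r addr0.
  have ak : a k <= a (k + N)%N.
    by elim: (N) => [|m IHm]; rewrite ?addn0// addnS (le_trans IHm).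
  have := le_trans ak (aD _ (k + N)%N D_gt0); rewrite -addnS -natr1 => h.
  have := lerD IH h; rewrite !mulrDl !mul1r => /le_trans; apply.
  by rewrite le_eqVlt; apply/orP; left; apply/eqP; rewrite addnS; ring.
move=> k; apply/eqP; rewrite eq_le a0 andbT; apply/ler_addgt0Pr => e e0.
rewrite add0r.
have e2 : 0 < e / 2 by rewrite divr_gt0.
have p10 : p - 1 != 0 by rewrite gt_eqF// subr_gt0.
(* this value makes the remainder D^(1-p) * C at most e / 2 *)
pose D := ((C + 1) / (e / 2)) `^ (p - 1)^-1.
have CD : 0 < (C + 1) / (e / 2) by rewrite divr_gt0// ltr_wpDl.
have D_gt0 : 0 < D by rewrite powR_gt0.
have DC : D `^ (1 - p) * C <= e / 2.
  rewrite /D -powRrM -(opprB p 1) mulrN mulVf// powR_inv1 ?(ltW CD)// invf_div.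
  rewrite mulrAC ler_pdivrMr ?ltr_wpDl// ler_pM2l// lerDl ler01//.
pose N := (Num.truncn (D * (2 * L) / (e / 2))).+1.
have N0 : 0 < N%:R :> R by rewrite ltr0n.
rewrite -(ler_pM2l N0); apply: (le_trans (sum D k N D_gt0)).
rewrite [X in _ <= _ * X](splitr e) [leRHS]mulrDr; apply: lerD; last by rewrite ler_pM2l.
apply: (@le_trans _ _ (D * (2 * L))).
  rewrite ler_pM2l//; apply: (le_trans _ (bdd (k + N)%N)); rewrite gerBl; exact: a0.
by rewrite -ler_pdivrMr// ltW// truncnS_gt.
Qed.

End hole_filling.

(** * Bounded weak solutions *)

Section weak_solutions.
Context (R : realType) (n : nat).
Local Notation V := 'rV[R]_n.
Local Notation mu := (@rV_lebesgue R n).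
Local Notation "''e_' i" := (delta_mx ord0 i : V) (at level 8, i at level 2).
Implicit Types (p c r : R) (f : V -> R) (G : V -> V) (i : 'I_n) (x y : V).

(** A weak solution of div(|G|^(p-2) G) = c, where the weak gradient G of f is
    bounded everywhere instead of almost everywhere. *)
Record weak_solution p c (gmax fmin : R) f G : Prop := WeakSolution {
  ws_continuous : continuous f;
  ws_ge : forall x, fmin <= f x;
  ws_measurable : forall i, measurable_fun setT (fun x => G x ord0 i);
  ws_bounded : forall x, enorm (G x) <= gmax;
  ws_gradient : forall psi : V -> R, test_function psi -> forall i,
    \int[mu]_x (f x * partial i psi x) = - \int[mu]_x (G x ord0 i * psi x);
  ws_equation : forall psi : V -> R, test_function psi ->
    \int[mu]_x dotrV (p_flux p (G x)) (gradient psi x) = - c * \int[mu]_x psi x }.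

Lemma measurable_enorm G : (forall i, measurable_fun setT (fun x => G x ord0 i)) ->
  measurable_fun setT (fun x => enorm (G x)).
Proof.
move=> mG; rewrite (_ : (fun x => _) = (fun x => dotrV (G x) (G x) `^ 2^-1)); last first.
  by apply/funext => x; rewrite powR12_sqrt// dotrV_ge0.
apply: (measurableT_comp (f := @powR R ^~ 2^-1) (g := fun x => dotrV (G x) (G x))).
  exact: measurable_powR.
by apply: measurable_sum => i; exact: measurable_funM.
Qed.

Lemma measurable_p_flux p G i :
  (forall j, measurable_fun setT (fun x => G x ord0 j)) ->
  measurable_fun setT (fun x => p_flux p (G x) ord0 i).
Proof.
move=> mG.
rewrite (_ : (fun x => _) = fun x => enorm (G x) `^ (p - 2) * G x ord0 i); last first.
  by apply/funext => x; rewrite /p_flux mxE.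
apply: measurable_funM => //.
exact: (measurableT_comp (f := @powR R ^~ (p - 2)) (measurable_powR _) (measurable_enorm mG)).
Qed.

Lemma locally_bounded_bounded (g : V -> R) (C : R) : measurable_fun setT g ->
  (forall x, `|g x| <= C) -> locally_bounded g.
Proof. by move=> mg gC; split=> // r; exists C. Qed.

Lemma cvg_expN (T : Type) (F : set_system T) (FF : Filter F) (g : T -> R) (l : R) :
  g @ F --> l -> expR (- g x) @[x --> F] --> expR (- l).
Proof.
move=> gl; apply: (@continuous_cvg _ _ _ F FF (- g) expR (- l)); last exact: cvgN.
exact: continuous_expR.
Qed.

Lemma continuous_expN (g : V -> R) : continuous g -> continuous (fun x => expR (- g x)).
Proof.
move=> cg; suff H (x : V) : expR (- g y) @[y --> x] --> expR (- g x) by move=> x; exact: H.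
exact: cvg_expN (cg x).
Qed.

Let sumr_flux (e z : R) (a d g : 'I_n -> R) :
  \sum_i a i * (e * d i - e * z * g i) =
  e * (\sum_i a i * d i) - e * (z * \sum_i a i * g i).
Proof.
rewrite mulrA !mulr_sumr -sumrB; apply: eq_bigr => i _; ring.
Qed.

Section solution.
Context (p c gmax fmin : R) (f : V -> R) (G : V -> V).
Hypotheses (p1 : 1 < p) (sol : weak_solution p c gmax fmin f G).

Let v x := enorm (G x).
Let A x i := p_flux p (G x) ord0 i.
Let B := gmax `^ (p - 1).

Let p0 : 0 < p. Proof. exact: lt_trans ltr01 p1. Qed.

Let mv : measurable_fun setT v.
Proof. exact: measurable_enorm (ws_measurable sol). Qed.

Let A_le x i : `|A x i| <= B.
Proof.
apply: (le_trans (p_flux_coord_le _ _ _)); apply: ge0_ler_powR.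
- by rewrite subr_ge0 ltW.
- by rewrite nnegrE enorm_ge0.
- by rewrite nnegrE (le_trans (enorm_ge0 (G 0)))// (ws_bounded sol).
- exact: ws_bounded sol x.
Qed.

Let B0 : 0 <= B. Proof. exact: powR_ge0. Qed.

Let lA i : locally_bounded (A^~ i).
Proof.
apply: (@locally_bounded_bounded _ B) => [|x]; last exact: A_le.
exact: measurable_p_flux (ws_measurable sol).
Qed.

Let G_le x i : `|G x ord0 i| <= gmax.
Proof. exact: le_trans (coord_le_enorm _ _) (ws_bounded sol x). Qed.

Let lG i : locally_bounded (fun x => G x ord0 i).
Proof. exact: (locally_bounded_bounded (ws_measurable sol i) (fun x => G_le x i)). Qed.

Let lf : locally_bounded f.
Proof. exact: continuous_locally_bounded (ws_continuous sol). Qed.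

Let vp_le x : v x `^ p <= gmax `^ p.
Proof.
apply: ge0_ler_powR; [exact: ltW|by rewrite nnegrE enorm_ge0| |exact: ws_bounded sol x].
by rewrite nnegrE (le_trans (enorm_ge0 (G 0)))// (ws_bounded sol).
Qed.

Let lvp : locally_bounded (fun x => v x `^ p).
Proof.
apply: (@locally_bounded_bounded _ (gmax `^ p)) => [|x].
  exact: (measurableT_comp (f := @powR R ^~ p) (measurable_powR _) mv).
by rewrite ger0_norm ?powR_ge0.
Qed.

Let energy_formE (psi : V -> R) :
  \int[mu]_x dotrV (p_flux p (G x)) (gradient psi x) =
  \int[mu]_x (\sum_i A x i * partial i psi x).
Proof.
apply: eq_Rintegral => x _; rewrite /dotrV.
by apply: eq_bigr => i _; rewrite [X in _ * X]mxE.
Qed.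

Let flux_bounded_support (psi : 'I_n -> V -> R) :
  (forall i, bounded_support (psi i)) ->
  bounded_support (fun x => \sum_i A x i * psi i x).
Proof.
move=> bpsi; apply: bounded_support_sum => i.
by under eq_fun do rewrite mulrC; exact: bounded_supportM.
Qed.

(** A bounded flux has no constant divergence but 0: its flow out of a cube grows
    like the surface, the total divergence like the volume. *)
Lemma tension_eq0 : c = 0.
Proof.
have [K K0 hK] := @partial_cutoff_le R n.
have main r : 0 < r -> `|c| <= n%:R * (B * K) * 2 ^+ n / r.
  move=> r0; have tr := test_cutoff n r0.
  have Q0 : 0 < (2 * r) ^+ n by rewrite exprn_gt0// mulr_gt0.
  have I1 : (2 * r) ^+ n <= \int[mu]_x cutoff r x.
    rewrite (_ : (2 * r) ^+ n = fine (mu (cube r))); last first.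
      by rewrite rV_lebesgue_cube// ltW.
    rewrite -[leLHS]mul1r -Rintegral_cst; last exact: measurable_cube.
    rewrite Rintegral_mkcond; apply: le_Rintegral => //.
    - have := @locally_bounded_integrable R n _ r (locally_bounded_cst n 1).
      move=> /(integrable_mkcond _ (measurable_cube r)); apply: eq_integrable => // x _.
      by rewrite restrict_EFin.
    - exact/bounded_support_integrable/test_bounded_support.
    - move=> x _; rewrite patchE; case: ifPn => [|_]; last exact: cutoff_ge0.
      by rewrite inE => xr; rewrite cutoff1.
  have I2 : `|\int[mu]_x (\sum_i A x i * partial i (cutoff r) x)| <=
      n%:R * (B * (K / r)) * (2 * (2 * r)) ^+ n.
    have := flux_bounded_support (fun i => test_bounded_support (test_partial i tr)).
    move=> [mF _]; apply: Rintegral_cube_bound => //.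
    - by rewrite mulr_ge0// ltW.
    - move=> x _; apply: (le_trans (ler_norm_sum _ _ _)).
      rewrite -[X in X%:R * _](card_ord n) mulr_natl -sumr_const.
      by apply: ler_sum => i _; rewrite normrM ler_pM// hK.
    - move=> x xr; rewrite big1// => i _.
      rewrite (@partial_support R n (cutoff r) (2 * r) i _ x xr) ?mulr0//.
      by move=> y; exact: cutoff0.
  have := ws_equation sol tr; rewrite energy_formE => E.
  move: I2; rewrite E mulNr normrN normrM (ger0_norm (le_trans (ltW Q0) I1)) => I2.
  have h := le_trans (ler_wpM2l (normr_ge0 c) I1) I2.
  rewrite (exprMn _ 2 (2 * r)) [leRHS]mulrA ler_pM2r// in h; apply: (le_trans h).
  by rewrite le_eqVlt; apply/orP; left; apply/eqP; ring.
apply/eqP; rewrite -normr_eq0 eq_le normr_ge0 andbT; apply/ler_addgt0Pr => e e0.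
rewrite add0r; pose T := n%:R * (B * K) * 2 ^+ n.
have T0 : 0 <= T by rewrite !mulr_ge0// exprn_ge0.
have r0 : 0 < (T + 1) / e by rewrite divr_gt0// ltr_wpDl.
apply: (le_trans (main _ r0)); rewrite -/T invf_div mulrCA ger_pMr//.
by rewrite ler_pdivrMr ?ltr_wpDl// mul1r lerDl.
Qed.

Let mol m := @mollifier R n (@scale R m).
Let tmol m : test_function (mol m). Proof. exact/test_mollifier/scale_gt0. Qed.
Let fm m := conv f (mol m).
Let gm m i := conv (fun y => G y ord0 i) (mol m).
Let E x := expR (- f x).
Let Em m x := expR (- fm m x).

Let smooth_fm m : smooth (fm m). Proof. exact: smooth_conv. Qed.

Let partial_fm m i : partial i (fm m) = gm m i.
Proof. exact: (partial_conv i (ws_continuous sol) (ws_gradient sol) (tmol m)). Qed.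

Let smooth_Em m : smooth (Em m). Proof. exact: smooth_expN. Qed.

Let lgm m i : locally_bounded (gm m i).
Proof. by apply: continuous_locally_bounded; exact: conv_continuous. Qed.

Let lEm m : locally_bounded (Em m).
Proof. exact/continuous_locally_bounded/smooth_continuous. Qed.

Let Em_le m x : Em m x <= expR (- fmin).
Proof.
rewrite ler_expR lerN2; apply: mollify_ge => //; first exact: scale_gt0.
exact: ws_ge sol.
Qed.

Let E_le x : E x <= expR (- fmin).
Proof. by rewrite ler_expR lerN2 (ws_ge sol). Qed.

Let lE : locally_bounded E.
Proof.
by apply: continuous_locally_bounded; apply: continuous_expN; exact: ws_continuous sol.
Qed.

Let cvg_Em x : Em m x @[m --> \oo] --> E x.
Proof.
exact: cvg_expN (mollify_cvg (ws_continuous sol)).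
Qed.

Let cvg_weight (W : V -> R) : bounded_support W ->
  \int[mu]_x (Em m x * W x) @[m --> \oo] --> \int[mu]_x (E x * W x).
Proof.
move=> bW; have [mW _] := bW.
apply: (@Rintegral_dominated_cvg _ _ _ mu setT _ _ (fun x => expR (- fmin) * `|W x|)) => //.
- by move=> m; apply: measurable_funM => //; exact: (lEm m).1.
- by apply: measurable_funM => //; exact: lE.1.
- by move=> x _; apply: cvgM; [exact: cvg_Em|exact: cvg_cst].
- have := integrableZl measurableT (expR (- fmin))
    (integrable_norm (bounded_support_integrable bW)).
  by apply: eq_integrable => // x _; rewrite /= EFinM.
- move=> m x _; rewrite normrM ger0_norm ?expR_ge0// ler_wpM2r//.
Qed.

Let L1_norm_sum r (s : seq 'I_n) (d : 'I_n -> V -> R) :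
  (forall i, locally_bounded (d i)) -> 0 <= r ->
  L1_norm r (fun x => \sum_(i <- s) `|d i x|) <= \sum_(i <- s) L1_norm r (d i).
Proof.
move=> ld r0; elim: s => [|i s IH].
  rewrite big_nil -[leRHS](mul0r ((2 * r) ^+ n)); apply: L1_norm_le_cst => //.
    by under eq_fun do rewrite big_nil; exact: locally_bounded_cst.
  by move=> x _; rewrite big_nil normr0.
have ls t : locally_bounded (fun x => \sum_(i <- t) `|d i x|).
  by apply: locally_bounded_sum => j; exact: locally_bounded_norm.
rewrite big_cons; apply: le_trans (lerD (lexx _) IH).
apply: L1_norm_leD => // x _; rewrite big_cons.
by apply: (le_trans (ler_normD _ _)); rewrite normr_id.
Qed.

Let cvg_L1_sum r : 0 <= r ->
  \sum_i L1_norm r (fun x => gm m i x - G x ord0 i) @[m --> \oo] --> (0 : R).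
Proof.
move=> r0; elim: (index_enum _) => [|i s IH].
  by under eq_fun do rewrite big_nil; exact: cvg_cst.
under eq_fun do rewrite big_cons.
have H := cvgD (mollify_L1_cvg r0 (ws_measurable sol i) (fun x => G_le x i)) IH.
rewrite addr0 in H; exact: H.
Qed.

(** The equation tested with [exp(-f) * zeta]. Testing with the mollified function
    and passing to the limit requires the mollified gradients to converge
    strongly, since they are multiplied by the flux. *)
Lemma energy_identity (zeta : V -> R) : test_function zeta ->
  \int[mu]_x (E x * (zeta x * v x `^ p)) =
  \int[mu]_x (E x * \sum_i A x i * partial i zeta x).
Proof.
move=> tz; have bz := test_bounded_support tz.
have bdz i := test_bounded_support (test_partial i tz).
have bD := flux_bounded_support bdz.
have lg m : locally_bounded (fun x => \sum_i A x i * gm m i x).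
  by apply: locally_bounded_sum => i; exact: locally_boundedM.
have [r z0] := test_function_support tz.
have eq m : \int[mu]_x (Em m x * \sum_i A x i * partial i zeta x) =
    \int[mu]_x (Em m x * (zeta x * \sum_i A x i * gm m i x)).
  have tpsi : test_function (fun x => Em m x * zeta x).
    apply: (@test_functionI _ _ _ r); first exact: (smoothM (smooth_Em m) tz.1).
    by move=> x /z0 ->; rewrite mulr0.
  have dpsi i : partial i (fun x => Em m x * zeta x) =
      fun x => Em m x * partial i zeta x - Em m x * zeta x * gm m i x.
    apply: partial_eq => x.
    have D1 : is_derive (fm m x) 1 (fun t : R => expR (- t)) (expR (- fm m x) * -1).
      exact: (@is_derive1_comp R expR -%R _ _ _ (is_derive_expR _) (is_deriveNid _ _)).
    have D2 := is_derive_comp1 D1 (smooth_is_derive i x (smooth_fm m)).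
    have D3 := is_deriveM D2 (smooth_is_derive i x tz.1).
    apply: (is_derive_eq D3); rewrite partial_fm /GRing.scale /= /Em; ring.
  have := ws_equation sol tpsi; rewrite energy_formE tension_eq0 oppr0 mul0r.
  have -> : (fun x => \sum_i A x i * partial i (fun x => Em m x * zeta x) x) =
      (fun x => Em m x * (\sum_i A x i * partial i zeta x) -
                Em m x * (zeta x * \sum_i A x i * gm m i x)).
    apply/funext => x; rewrite -sumr_flux; apply: eq_bigr => i _.
    by rewrite dpsi.
  rewrite RintegralB//; last 2 first.
  - apply: bounded_support_integrable; under eq_fun do rewrite mulrC.
    exact: bounded_supportM.
  - apply: bounded_support_integrable; under eq_fun do rewrite mulrC.
    by apply: bounded_supportM => //; exact: bounded_supportM.
  by move/subr0_eq.
have I := cvg_weight bD.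
have P := cvg_weight (bounded_supportM bz lvp).
pose J m := \int[mu]_x (Em m x * (zeta x * \sum_i A x i * gm m i x)).
have [Z zZ] := test_bounded tz.
pose K := expR (- fmin) * (Z * B).
have Z0 : 0 <= Z by apply: le_trans (zZ 0).
have K0 : 0 <= K by rewrite mulr_ge0 ?expR_ge0// mulr_ge0.
pose s := `|r|.
have zs x : ~ cube s x -> zeta x = 0.
  move=> xs; apply: z0; apply: contra_not xs; apply: cube_le; exact: ler_norm.
have JP m : `|J m - \int[mu]_x (Em m x * (zeta x * v x `^ p))| <=
    K * \sum_i L1_norm s (fun x => gm m i x - G x ord0 i).
  pose d i x := gm m i x - G x ord0 i.
  have ld i : locally_bounded (d i) by exact: locally_boundedB.
  pose H x := Em m x * (zeta x * \sum_i A x i * d i x).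
  have bH : bounded_support H.
    rewrite /H; under eq_fun do rewrite mulrC.
    apply: bounded_supportM => //; apply: bounded_supportM => //.
    by apply: locally_bounded_sum => i; exact: locally_boundedM.
  have -> : J m - \int[mu]_x (Em m x * (zeta x * v x `^ p)) = \int[mu]_x H x.
    rewrite /J -RintegralB//; last 2 first.
    - apply: bounded_support_integrable; under eq_fun do rewrite mulrC.
      by apply: bounded_supportM => //; exact: bounded_supportM.
    - apply: bounded_support_integrable; under eq_fun do rewrite mulrC.
      by apply: bounded_supportM => //; exact: bounded_supportM.
    congr (Rintegral _ _ _); apply/funext => x.
    rewrite -mulrBr -mulrBr /v -(dotrV_p_flux _ p0) /dotrV -sumrB /H.
    by congr (_ * (_ * _)); apply: eq_bigr => i _; rewrite -mulrBr.
  have -> : \int[mu]_x H x = \int[mu]_(x in cube s) H x.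
    rewrite [RHS]Rintegral_mkcond; congr (Rintegral _ _ _); apply/funext => x.
    rewrite patchE; case: ifPn => // /negP; rewrite inE => /zs zx.
    by rewrite /H zx mul0r mulr0.
  have lH : locally_bounded H.
    apply: locally_boundedM => //; apply: locally_boundedM.
      exact/continuous_locally_bounded/smooth_continuous/tz.1.
    by apply: locally_bounded_sum => i; exact: locally_boundedM.
  apply: (le_trans (le_normr_Rintegral (measurable_cube s) (locally_bounded_integrable s lH))).
  have ls : locally_bounded (fun x => \sum_i `|d i x|).
    by apply: locally_bounded_sum => i; exact: locally_bounded_norm.
  have s0 : 0 <= s by rewrite /s normr_ge0.
  apply: le_trans (ler_wpM2l K0 (L1_norm_sum (index_enum _) ld s0)).
  rewrite -{1}(ger0_norm K0) -L1_normZ//.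
  apply: le_Rintegral; first exact: measurable_cube.
  - exact/locally_bounded_integrable/locally_bounded_norm.
  - apply/locally_bounded_integrable/locally_bounded_norm.
    by apply: locally_boundedM => //; exact: locally_bounded_cst.
  - move=> x _; rewrite [leRHS]normrM (ger0_norm K0) /H [leLHS]normrM /K -!mulrA.
    rewrite (ger0_norm (expR_ge0 _)) normrM; apply: ler_pM; [exact: expR_ge0|by rewrite mulr_ge0|exact: Em_le|].
    apply: ler_pM => //; rewrite [X in _ * X]ger0_norm ?sumr_ge0// mulr_sumr.
    apply: (le_trans (ler_norm_sum _ _ _)); apply: ler_sum => i _.
    by rewrite normrM ler_wpM2r.
have lim : J m - \int[mu]_x (Em m x * (zeta x * v x `^ p)) @[m --> \oo] --> (0 : R).
  have s0 : 0 <= s by rewrite /s normr_ge0.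
  have KS : K * \sum_i L1_norm s (fun x => gm m i x - G x ord0 i)
      @[m --> \oo] --> K * 0.
    by apply: cvgM; [exact: cvg_cst|exact: cvg_L1_sum].
  rewrite mulr0 in KS.
  apply/cvgr0Pnorm_le => e e0; move: KS => /cvgr0Pnorm_le/(_ _ e0).
  by apply: filterS => m; apply: le_trans; apply: le_trans (JP m) (ler_norm _).
have lim2 : J m - \int[mu]_x (Em m x * (zeta x * v x `^ p)) @[m --> \oo] -->
    \int[mu]_x (E x * \sum_i A x i * partial i zeta x) -
    \int[mu]_x (E x * (zeta x * v x `^ p)).
  by rewrite /J; under eq_fun do rewrite -eq; apply: cvgB.
have e0 := cvg_unique _ lim2 lim.
by apply/esym/eqP; rewrite -subr_eq0 e0.
Qed.

Let w x := E x * v x `^ p.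

Let lw : locally_bounded w. Proof. exact: locally_boundedM. Qed.

Let w_ge0 x : 0 <= w x. Proof. by rewrite mulr_ge0 ?expR_ge0 ?powR_ge0. Qed.

Let a r := \int[mu]_x (\1_(cube r) x * w x).

Let indic_bounded_support r : bounded_support (\1_(cube r) : V -> R).
Proof.
split; first by apply: measurable_indic; exact: measurable_cube.
exists r, 1; split=> x; first by rewrite indicE; case: (_ \in _); rewrite ?normr1 ?normr0.
by move=> xr; rewrite indicE memNset.
Qed.

Let indic_w r : bounded_support (fun x => \1_(cube r) x * w x).
Proof. exact: bounded_supportM. Qed.

Let a_ge0 r : 0 <= a r.
Proof. by apply: Rintegral_ge0 => x _; rewrite mulr_ge0// indicE. Qed.

Let a_mono r s : r <= s -> a r <= a s.
Proof.
move=> rs; apply: le_Rintegral => //; [exact: bounded_support_integrable..|].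
move=> x _; rewrite ler_wpM2r// !indicE; have [xr|xr] := pselect (cube r x).
  by rewrite !mem_set//; exact: cube_le xr.
by rewrite (memNset xr).
Qed.

Let indic_int r : 0 <= r -> \int[mu]_x (\1_(cube r) x : R) = (2 * r) ^+ n.
Proof.
move=> r0; rewrite /Rintegral integral_indic//; last exact: measurable_cube.
by rewrite setIT; exact: (congr1 fine (rV_lebesgue_cube n r0)).
Qed.

Let a_growth r : 0 <= r -> a r <= expR (- fmin) * gmax `^ p * (2 * r) ^+ n.
Proof.
move=> r0; rewrite -indic_int// -RintegralZl//; last exact: bounded_support_integrable.
apply: le_Rintegral => //; first exact: bounded_support_integrable.
  exact: (integrableZl measurableT _ (bounded_support_integrable (indic_bounded_support r))).
move=> x _; rewrite mulrC ler_wpM2r ?indicE//.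
by rewrite ler_pM ?expR_ge0 ?powR_ge0.
Qed.

(** The gradient of the cutoff lives in the shell between the two cubes, where
    Young's inequality splits it from the flux. What it contributes is of order
    r^(n-p), hence bounded because [r >= 1] and [n <= p]. *)
Let solution_shell (K r D : R) : n%:R <= p -> 0 <= K ->
  (forall i x, `|partial i (@cutoff R n r) x| <= K / r) -> 1 <= r -> 0 < D ->
  a r <= D * (a (2 * r) - a r) +
    D `^ (1 - p) * ((n%:R * K) `^ p * expR (- fmin) * 4 ^+ n).
Proof.
move=> np K0 hK r1 D0; have r0 : 0 < r by apply: lt_le_trans r1.
have tr := test_cutoff n r0; have br := test_bounded_support tr.
pose T := n%:R * (K / r).
have T0 : 0 <= T by rewrite mulr_ge0// divr_ge0// ltW.
pose Q := D `^ (1 - p) * T `^ p * expR (- fmin).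
have Q0 : 0 <= Q by rewrite !mulr_ge0 ?powR_ge0 ?expR_ge0.
have left : a r <= \int[mu]_x (E x * (cutoff r x * v x `^ p)).
  apply: le_Rintegral => //; first exact: bounded_support_integrable.
    apply: bounded_support_integrable; under eq_fun do rewrite mulrCA.
    exact: bounded_supportM.
  move=> x _; rewrite [leRHS]mulrCA -/(w x) ler_wpM2r// indicE.
  have [xr|xr] := pselect (cube r x); first by rewrite mem_set// cutoff1.
  by rewrite memNset// cutoff_ge0.
have right : \int[mu]_x (E x * \sum_i A x i * partial i (cutoff r) x) <=
    \int[mu]_x (D * (\1_(cube (2 * r)) x * w x - \1_(cube r) x * w x) +
      Q * \1_(cube (2 * r)) x).
  apply: le_Rintegral => //.
  - apply: bounded_support_integrable; under eq_fun do rewrite mulrC.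
    apply: bounded_supportM => //; apply: flux_bounded_support => i.
    exact/test_bounded_support/test_partial.
  - have i1 := bounded_support_integrable (indic_w (2 * r)).
    have i2 := bounded_support_integrable (indic_w r).
    have i3 := bounded_support_integrable (indic_bounded_support (2 * r)).
    exact: (integrableD measurableT
      (integrableZl measurableT D (integrableB measurableT i1 i2))
      (integrableZl measurableT Q i3)).
  move=> x _; have [xr|xr] := pselect (cube r x).
    have xr2 : cube (2 * r) x.
      by apply: cube_le xr; rewrite ler_peMl// ?ler1n// ltW.
    rewrite !indicE !mem_set// subrr mulr0 add0r mulr1 big1 ?mulr0// => i _.
    by rewrite partial_cutoff_eq0 ?mulr0.
  have [xr2|xr2] := pselect (cube (2 * r) x); last first.
    rewrite !indicE !memNset// !mul0r subrr !mulr0 addr0 big1 ?mulr0// => i _.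
    rewrite (@partial_support R n (cutoff r) (2 * r) i _ x xr2) ?mulr0//.
    by move=> y; exact: cutoff0.
  rewrite !indicE (memNset xr) mem_set// mul0r subr0 mul1r mulr1.
  apply: (@le_trans _ _ (E x * (v x `^ (p - 1) * T))).
    rewrite ler_wpM2l ?expR_ge0//; apply: (le_trans (ler_norm _)).
    apply: (le_trans (ler_norm_sum _ _ _)).
    rewrite /T mulrCA -[X in X%:R * _](card_ord n) mulr_natl -sumr_const.
    by apply: ler_sum => i _; rewrite normrM ler_pM// p_flux_coord_le.
  apply: (le_trans (ler_wpM2l (expR_ge0 _) (young p1 D0 (enorm_ge0 (G x)) T0))).
  rewrite mulrDr /w mulrCA lerD2l /Q [leRHS]mulrC.
  by apply: ler_wpM2r; [rewrite mulr_ge0 ?powR_ge0|exact: E_le].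
apply: (le_trans left); rewrite energy_identity//; apply: (le_trans right).
have i1 := bounded_support_integrable (indic_w (2 * r)).
have i2 := bounded_support_integrable (indic_w r).
have i3 := bounded_support_integrable (indic_bounded_support (2 * r)).
have i4 := integrableB measurableT i1 i2.
rewrite RintegralD//; last 2 first.
- exact: (integrableZl measurableT D i4).
- exact: (integrableZl measurableT Q i3).
rewrite RintegralZl// RintegralB// RintegralZl// -/(a _) -/(a _) lerD2l.
rewrite indic_int; last by rewrite mulr_ge0// ltW.
rewrite /Q -!mulrA ler_wpM2l ?powR_ge0// [leRHS]mulrCA [leLHS]mulrCA.
rewrite ler_wpM2l ?expR_ge0//.
rewrite (_ : 2 * (2 * r) = 4 * r); last by ring.
rewrite exprMn mulrCA [leRHS]mulrC ler_wpM2l ?exprn_ge0//.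
rewrite /T mulrA powRM; [|by rewrite mulr_ge0|by rewrite invr_ge0 ltW].
rewrite -mulrA ler_piMr ?powR_ge0//.
rewrite -[r^-1]powR_inv1; last exact: ltW.
rewrite -powRrM mulN1r powRN ler_pdivrMl ?powR_gt0// mulr1.
by rewrite -powR_mulrn ?(ltW r0)//; apply: ler_powR.
Qed.

Let a_eq0 k : n%:R <= p -> a (2 ^+ k) = 0.
Proof.
move=> np; have [K K0 hK] := @partial_cutoff_le R n.
have two1 j : 1 <= 2 ^+ j :> R by rewrite exprn_ege1// ler1n.
move: k; apply: (@hole_filling _ _ p (2 ^+ n)
  (expR (- fmin) * gmax `^ p * 2 ^+ n) ((n%:R * K) `^ p * expR (- fmin) * 4 ^+ n)) => //.
- by rewrite !mulr_ge0 ?powR_ge0 ?expR_ge0 ?exprn_ge0.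
- by move=> k; apply: a_mono; rewrite exprS ler_peMl// ?ler1n// exprn_ge0.
- move=> k; apply: (le_trans (a_growth _)); first by rewrite exprn_ge0.
  by rewrite exprMn -!mulrA -!exprM mulnC.
- move=> D k D0; rewrite exprS; apply: solution_shell => //.
  by move=> i x; apply: hK; rewrite (lt_le_trans _ (two1 k)).
Qed.

(** Young's inequality bounds |G| by D + D^(1-p) |G|^p. The second term has
    integral 0 in every cube, and D is arbitrary. *)
Let gm_eq0 m i x : n%:R <= p -> gm m i x = 0.
Proof.
move=> np; have tm := tmol m; set k := mol m in tm *.
have k0 y : 0 <= k y by apply: mollifier_ge0; exact: scale_gt0.
have k1 : \int[mu]_y k (x - y) = 1 by apply: Rintegral_mollifier; exact: scale_gt0.
have bk := test_bounded_support (test_reflect x tm).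
have [r hr] := test_function_support (test_reflect x tm).
pose N := (Num.truncn `|r|).+1.
have rN : r <= 2 ^+ N.
  apply: (le_trans (ler_norm r)); apply: (@le_trans _ _ N%:R).
    exact/ltW/truncnS_gt.
  by rewrite -natrX ler_nat ltnW// ltn_expl.
have [F hF] := lf.2 (2 ^+ N).
have [S hS] := test_bounded tm.
have ik := bounded_support_integrable bk.
have iw := bounded_support_integrable (indic_w (2 ^+ N)).
apply/eqP; rewrite -normr_le0; apply/ler_addgt0Pr => D D0; rewrite add0r.
pose M := D `^ (1 - p) * (expR F * S).
apply: (@le_trans _ _ (\int[mu]_y (D * k (x - y) + M * (\1_(cube (2 ^+ N)) y * w y)))).
  apply: (le_trans (le_normr_Rintegral measurableT (conv_integrable x (lG i) tm))).
  apply: le_Rintegral => //.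
  - by apply: integrable_norm; exact: conv_integrable.
  - exact: (integrableD measurableT (integrableZl measurableT D ik)
      (integrableZl measurableT M iw)).
  move=> y _; have [yN|yN] := pselect (cube (2 ^+ N) y); last first.
    have y0 : k (x - y) = 0 by apply: hr; apply: contra_not yN; exact: cube_le.
    by rewrite y0 !mulr0 normr0 add0r indicE memNset// mul0r mulr0.
  rewrite indicE mem_set// mul1r normrM (ger0_norm (k0 _)).
  apply: (le_trans (ler_wpM2r (k0 _) (coord_le_enorm (G y) i))).
  have := young p1 D0 ler01 (enorm_ge0 (G y)); rewrite !powR1 mul1r mulr1 => h.
  apply: (le_trans (ler_wpM2r (k0 _) h)); rewrite mulrDl lerD2l /M -!mulrA.
  rewrite ler_wpM2l ?powR_ge0// /w (mulrC (E y)) mulrCA [leRHS]mulrA [leRHS]mulrC.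
  rewrite -/(v y) -!mulrA ler_wpM2l ?powR_ge0// mulrCA.
  have SE : k (x - y) <= S by apply: (le_trans (ler_norm _)).
  apply: (le_trans SE); rewrite ler_peMr//; first exact: le_trans SE.
  rewrite /E -expRD -expR0 ler_expR.
  have := hF y yN; have := ler_norm (f y); lra.
rewrite RintegralD//; last 2 first.
- exact: (integrableZl measurableT D ik).
- exact: (integrableZl measurableT M iw).
rewrite RintegralZl// RintegralZl// k1 -/(a _) a_eq0// mulr0 addr0 mulr1.
exact: lexx.
Qed.

Lemma weak_solution_const : n%:R <= p -> forall x y, f x = f y.
Proof.
move=> np x y; have c0 m : fm m x = fm m y.
  apply: smooth_const => // i z; rewrite partial_fm; exact: gm_eq0.
have := mollify_cvg (x := x) (ws_continuous sol).
rewrite (_ : (fun m => _) = fm^~ y); last by apply/funext => m; exact: c0.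
move=> h; exact: (cvg_unique _ h (mollify_cvg (ws_continuous sol))).
Qed.

End solution.
End weak_solutions.

(** * The theorem *)

Section truncation.
Context d (T : measurableType d) (R : realType) (mu : {measure set T -> \bar R}).

Lemma ae_eq_Rintegral (F H : T -> R) : measurable_fun setT F -> measurable_fun setT H ->
  {ae mu, forall x, F x = H x} -> \int[mu]_x F x = \int[mu]_x H x.
Proof.
move=> mF mH FH; congr fine; apply: ae_eq_integral => //; [exact/measurable_EFinP..|].
by apply: filterS FH => x ->.
Qed.

End truncation.

(** Only the values of the weak gradient on a null set are changed. *)
Lemma weak_solution_truncate (R : realType) (n : nat) (p c : R) (f : 'rV[R]_n -> R) :
  sobolev_loc p f -> continuous f -> has_lbound (range f) ->
  constant_p_tension p c f -> bounded_weak_derivative f ->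
  exists gmax fmin G, weak_solution p c gmax fmin f G.
Proof.
move=> [_ [G0 wG0 _]] cf [fmin fge] tension [C _ aeC].
have [_ lG ibp] : is_weak_gradient f (weak_gradient f).
  exact: (@xgetPex _ (fun=> 0) [set G | is_weak_gradient f G]) (ex_intro _ G0 wG0).
move: tension aeC; rewrite /constant_p_tension /p_energy_form.
move: (weak_gradient f) lG ibp => G lG ibp tension aeC.
have mG i : measurable_fun setT (fun x => G x ord0 i) by have [] := lG i.
pose S := [set x | enorm (G x) <= C].
have mS : measurable S.
  have := measurable_enorm mG measurableT (measurable_itv `]-oo, C]).
  by rewrite setTI; congr (measurable _); apply/seteqP; split=> x; rewrite /= in_itv.
pose H x := (\1_S x : R) *: G x.
have HG : {ae (rV_lebesgue R n), forall x, H x = G x}.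
  by apply: filterS aeC => x Cx; rewrite /H indicE mem_set// scale1r.
have mH i : measurable_fun setT (fun x => H x ord0 i).
  rewrite (_ : (fun x => _) = fun x => \1_S x * G x ord0 i); last first.
    by apply/funext => x; rewrite mxE.
  by apply: measurable_funM => //; exact: measurable_indic.
have mtest (psi : 'rV[R]_n -> R) i : test_function psi ->
    measurable_fun setT (partial i psi).
  by move=> tpsi; have [] := test_bounded_support (test_partial i tpsi).
have mpsi (psi : 'rV[R]_n -> R) : test_function psi -> measurable_fun setT psi.
  by move=> tpsi; have [] := test_bounded_support tpsi.
exists `|C|, fmin, H; split=> //.
- by move=> x; apply: fge; exists x.
- move=> x; rewrite /H indicE; have [xS|xS] := pselect (S x).
    by rewrite mem_set// scale1r; apply: (le_trans xS); exact: ler_norm.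
  rewrite memNset// scale0r /enorm /dotrV big1 ?sqrtr0// => i _.
  by rewrite mxE mul0r.
- move=> psi tpsi i; rewrite ibp//; congr (- _); apply: ae_eq_Rintegral.
  + by apply: measurable_funM => //; exact: mpsi.
  + by apply: measurable_funM => //; exact: mpsi.
  + by apply: filterS HG => x ->.
- move=> psi tpsi; rewrite -tension//.
  have mflux (K : 'rV[R]_n -> 'rV[R]_n) : (forall i, measurable_fun setT (fun x => K x ord0 i)) ->
      measurable_fun setT (fun x => dotrV (p_flux p (K x)) (gradient psi x)).
    move=> mK; rewrite /dotrV; apply: measurable_sum => i; apply: measurable_funM.
      exact: measurable_p_flux.
    rewrite (_ : (fun x => _) = partial i psi); first exact: mtest.
    by apply/funext => x; rewrite mxE.
  by apply: ae_eq_Rintegral; [exact: mflux|exact: mflux|apply: filterS HG => x ->].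
Qed.

Theorem theorem4p1 (R : realType) (n : nat) (p : R) (f : 'rV[R]_n -> R)
    (hn : (0 < n)%N) (hp : 1 < p) (hnp : n%:R <= p)
    (hW : sobolev_loc p f) (hcont : continuous f)
    (hbelow : has_lbound (range f))
    (hsub : weak_subsolution p f)
    (htension : exists c : R, constant_p_tension p c f)
    (hgrad : bounded_weak_derivative f) :
  exists k : R, forall x : 'rV[R]_n, f x = k.
Proof.
have [c hc] := htension.
have [gmax [fmin [G sol]]] := weak_solution_truncate hW hcont hbelow hc hgrad.
by exists (f 0) => x; exact: (weak_solution_const hp sol hnp).
Qed.
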